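(* If $x\in 2^\omega$ is left-c.e. and $a\in[0,1]$ is left-c.e. and 1-random, then there is an optimal prefix-free machine $V$ such that $f_V(x)=a$, where $f_V(x)=\sum_{\sigma\le_L x}2^{-K_V(\sigma)}$.
   Context: A machine is a partial computable function $M$ from $2^{<\omega}$ to $2^{<\omega}$; it is prefix-free if its domain is a prefix-free set. $K_M(\sigma)=\min\{|\tau|: M(\tau)=\sigma\}$ ($=\infty$ if there is no such $\tau$, with $2^{-\infty}=0$). A prefix-free machine $V$ is optimal if for each prefix-free machine $M$ there is a constant $c$ with $K_V(\sigma)\le K_M(\sigma)+c$ for all $\sigma$. For $\sigma\in 2^{<\omega}$ and $x\in 2^\omega$, $\sigma<_L x$ means that there is $n$ with $\sigma\upharpoonright n=x\upharpoonright n$, $\sigma(n)=0$ and $x(n)=1$; $\sigma\le_L x$ means that $\sigma<_L x$ or $\sigma$ is an initial segment of $x$. A real (in $[0,1]$, or in $2^\omega$ viewed as a binary expansion) is left-c.e. if there is a computable nondecreasing sequence of rationals converging to it. A real $y$ is 1-random if there is a constant $c$ with $K_U(y\upharpoonright n)\ge n-c$ for all $n$, for a fixed optimal prefix-free machine $U$ (the notion does not depend on $U$). *)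

(* Defs.v *)
From HB Require Import structures.
From Stdlib Require Cantor.
From mathcomp Require Import all_boot all_order all_algebra.
From mathcomp Require Import all_classical all_reals all_analysis.

Set Implicit Arguments.
Unset Strict Implicit.
Unset Printing Implicit Defensive.

Import Order.TTheory GRing.Theory Num.Theory.
Import numFieldNormedType.Exports.

Local Open Scope classical_set_scope.
Local Open Scope ring_scope.

(* Partial recursive functions, presented as unary functions on nat; several
   arguments are passed through Cantor's bijective pairing, so that the
   projections are the two components of [Cantor.of_nat]. *)
Inductive code : Type :=
| Zero
| Succ
| Fst
| Snd
| Pair of code & code
| Comp of code & code
| Prec of code & code
| Mu of code.

Notation "<| a , b |>" := (Cantor.to_nat (a, b))
  (at level 0, a at level 99, b at level 99, format "<| a ,  b |>").

(* Graph of the function h with h(a, 0) = F(a) and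
   h(a, k + 1) = G(a, k, h(a, k)). *)
Fixpoint prec_graph (F G : nat -> nat -> Prop) (a k v : nat) : Prop :=
  if k is k'.+1
  then exists2 u, prec_graph F G a k' u & G <|a, <|k', u|>|> v
  else F a v.

(* [eval c n m]: the computation of [c] on input [n] halts with output [m].
   The search [Mu f] only halts if all values before the first zero are
   defined. *)
Fixpoint eval (c : code) (n m : nat) : Prop :=
  match c with
  | Zero => m = 0%N
  | Succ => m = n.+1
  | Fst => m = (Cantor.of_nat n).1
  | Snd => m = (Cantor.of_nat n).2
  | Pair f g => exists a b, [/\ eval f n a, eval g n b & m = <|a, b|>]
  | Comp f g => exists2 k, eval g n k & eval f k m
  | Prec f g =>
      prec_graph (eval f) (eval g) (Cantor.of_nat n).1 (Cantor.of_nat n).2 m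
  | Mu f => eval f <|n, m|> 0%N /\
      forall i, (i < m)%N -> exists v, eval f <|n, i|> v.+1
  end.

Definition computable (g : nat -> nat) : Prop :=
  exists c, forall n, eval c n (g n).

(* Bijective base-2 numeration, first bit least significant; this is a
   bijection between strings and natural numbers. *)
Fixpoint str_code (s : seq bool) : nat :=
  if s is b :: s' then ((str_code s').*2 + b).+1 else 0%N.

(* [M s = None] means that [M] is undefined at [s]. *)
Definition partial_computable (M : seq bool -> option (seq bool)) : Prop :=
  exists c, forall s t, M s = Some t <-> eval c (str_code s) (str_code t).

Definition prefix_free (D : set (seq bool)) : Prop :=
  forall s t, D s -> D t -> prefix s t -> s = t.

Definition prefix_free_machine (M : seq bool -> option (seq bool)) : Prop :=
  partial_computable M /\ prefix_free [set s | M s <> None].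

(* Natural numbers extended with infinity, represented by [None]. *)
Definition le_oo (k l : option nat) : bool :=
  match k, l with
  | _, None => true
  | None, Some _ => false
  | Some m, Some n => (m <= n)%N
  end.

Definition add_oo (k : option nat) (c : nat) : option nat :=
  omap (fun n => (n + c)%N) k.

Definition has_program (M : seq bool -> option (seq bool)) (s : seq bool) :
    pred nat :=
  fun n => `[< exists2 t, size t = n & M t = Some s >].

Definition K (M : seq bool -> option (seq bool)) (s : seq bool) : option nat :=
  if pselect (exists n, has_program M s n) is left ex
  then Some (ex_minn ex) else None.

Definition optimal (V : seq bool -> option (seq bool)) : Prop :=
  prefix_free_machine V /\
  forall M, prefix_free_machine M ->
    exists c, forall s, le_oo (K V s) (add_oo (K M s) c).

Definition restr (x : nat -> bool) (n : nat) : seq bool := mkseq x n.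

Definition lt_L (s : seq bool) (x : nat -> bool) : Prop :=
  exists n, [/\ (n < size s)%N, take n s = restr x n,
                nth false s n = false & x n = true].

Definition le_L (s : seq bool) (x : nat -> bool) : Prop :=
  lt_L s x \/ s = restr x (size s).

Definition random_seq (U : seq bool -> option (seq bool)) (y : nat -> bool) :
    Prop :=
  exists c, forall n, le_oo (Some n) (add_oo (K U (restr y n)) c).

Definition computable_rat_seq (q : nat -> rat) : Prop :=
  exists sg p d : nat -> nat,
    [/\ computable sg, computable p, computable d &
        forall n, q n = (-1) ^+ sg n * (p n)%:R / (d n).+1%:R].

Section Reals.
Variable R : realType.

Definition left_ce (r : R) : Prop :=
  exists q : nat -> rat,
    [/\ computable_rat_seq q,
        forall m n, (m <= n)%N -> q m <= q n &
        (fun n => ratr (q n) : R) @ \oo --> r].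

Definition binary_value (y : nat -> bool) : R :=
  limn (series (fun n => (y n)%:R / 2 ^+ n.+1 : R)).

(* A dyadic rational has two binary expansions, but neither of them is random,
   so quantifying existentially over the expansion is harmless. *)
Definition random_real (U : seq bool -> option (seq bool)) (r : R) : Prop :=
  exists2 y, binary_value y = r & random_seq U y.

Definition pow2_neg (k : option nat) : R := if k is Some n then 2 ^- n else 0.

Definition f_ (V : seq bool -> option (seq bool)) (x : nat -> bool) : \bar R :=
  \esum_(s in [set s | le_L s x]) (pow2_neg (K V s))%:E.

End Reals.

(* Main.v *)
Require Import Defs.
From mathcomp Require Import all_boot all_order all_algebra.
From mathcomp Require Import all_classical all_reals all_analysis.
From mathcomp Require Import zify lra ring.
Import Defs.

(** The theorem is a version of the completeness of random left-c.e. reals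
    (Kucera and Slaman; Calude, Hertling, Khoussainov and Wang), in which a sum
    over the left cut of [x] takes the place of the halting probability.

    Let [C] be the left cut, the set of strings [s] with [le_L s x].  It is
    computably enumerable because [x] is left-c.e. ([cut_enumerable]), and it
    contains every string of zeros.  Enumerate without repetition the atoms, that
    is, the computations [U tau = sigma] with [sigma] in [C]; and let [a] be the
    limit of the nondecreasing dyadic rationals [N s / 2 ^ s].

    Fix a constant [c].  The approximation pays for the atoms one after the other:
    having paid for the first [i] of them it waits for a stage at which it has
    grown by [2 ^- (c + size tau)] since the last payment, where [tau] is the
    program of the [i]-th atom.  If it waits forever, then [a] lies within
    [2 ^- (c + size tau)] above a number computed from [c] and [tau].  With
    [c = 2r] and [m = 2r + size tau] this leaves three candidates for the first [m]
    bits of [a], so they have a description of length [r + size tau + 3], namely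
    [1^r 0], two bits and [tau]; these descriptions are prefix-free because [U] is.
    As [a] is random, this is impossible for large [r], so all atoms are paid for
    ([random_never_stuck]).  In the same way [a] is not [1], since the strings of
    ones have short descriptions ([binary_value_lt1]); let also [2 ^- c <= 1 - a].

    The machine [V] copies [U] through the prefix [1^c], which makes it optimal.
    When an atom is paid for, the sum of [2 ^- K V sigma] over the strings of [C]
    considered so far grows by at most [2 ^- (c + size tau)], hence by no more than
    the approximation to [a] has grown.  The difference is an integer multiple of
    the current unit [2 ^- (s + 1)], and is made up by giving codewords of length
    [s + 1] to that many long strings of zeros, which had no description before.
    So the sum agrees with the approximation at every stage ([sum_wt]) and equals
    [a] in the limit ([esum_K]).  The codewords of a stage are taken in the dyadic
    interval between the previous and the present approximation; hence those of
    different stages are incomparable, and as they lie below [a <= 1 - 2 ^- c] none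
    is comparable with a string that starts with [1^c] ([vgraph_prefix]). *)

Set Implicit Arguments.
Unset Strict Implicit.
Unset Printing Implicit Defensive.

Import Order.TTheory GRing.Theory Num.Theory.
Import numFieldNormedType.Exports.

Local Open Scope nat_scope.

(** * Computable functions between coded types *)

Arguments Cantor.to_nat : simpl never.
Arguments Cantor.of_nat : simpl never.

(** Codes in [nat] make it possible to speak of computability for functions
    between pairs, options, strings and lists.  Strings are coded by [str_code],
    the coding through which machines are declared computable. *)
Class Enc (T : Type) := MkEnc { enc : T -> nat; enc_inj : injective enc }.

Definition Enc_nat : Enc nat := MkEnc (fun _ _ => id).
#[export] Existing Instance Enc_nat.

Lemma nat_of_bool_inj : injective nat_of_bool.
Proof. by case; case. Qed.
#[export] Instance Enc_bool : Enc bool := MkEnc nat_of_bool_inj.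

Section EncPairOption.
Context {A B : Type} {eA : Enc A} {eB : Enc B}.

Lemma enc_pair_inj : injective (fun p : A * B => <| enc p.1, enc p.2 |>).
Proof.
move=> [a b] [a' b'] /(congr1 Cantor.of_nat).
rewrite !Cantor.cancel_of_to => -[ea eb].
by rewrite (enc_inj ea) (enc_inj eb).
Qed.
#[export] Instance Enc_pair : Enc (A * B) := MkEnc enc_pair_inj.

Lemma enc_option_inj :
  injective (fun o : option A => if o is Some a then (enc a).+1 else 0).
Proof. by move=> [a|] [a'|] // [e]; rewrite (enc_inj e). Qed.
#[export] Instance Enc_option : Enc (option A) := MkEnc enc_option_inj.
End EncPairOption.

Lemma str_code_inj : injective str_code.
Proof.
elim=> [|b s IHs] [|b' s'] //= e.
have eb : b = b' by move: e; case: b; case: b' => //; lia.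
have es : str_code s = str_code s' by subst b'; lia.
by rewrite eb (IHs _ es).
Qed.
#[export] Instance Enc_str : Enc (seq bool) := MkEnc str_code_inj.

Fixpoint seq_code (l : seq nat) : nat :=
  if l is a :: l' then <| a, seq_code l' |>.+1 else 0.

Lemma seq_code_inj : injective seq_code.
Proof.
elim=> [|a l IHl] [|a' l'] //= -[] /(congr1 Cantor.of_nat).
by rewrite !Cantor.cancel_of_to => -[-> e]; rewrite (IHl _ e).
Qed.
#[export] Instance Enc_seq : Enc (seq nat) := MkEnc seq_code_inj.

(** The function on codes is required to be total, also outside the range of
    [enc]: the recursion behind a definition by cases on an option runs through
    numbers that code nothing. *)
Definition effective {A B : Type} {eA : Enc A} {eB : Enc B} (f : A -> B) : Prop :=
  exists2 g, computable g & forall x, g (enc x) = enc (f x).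

Definition effective2 {A B C : Type} {eA : Enc A} {eB : Enc B} {eC : Enc C}
  (f : A -> B -> C) : Prop := effective (fun p => f p.1 p.2).

Definition effective3 {A B C D : Type} {eA : Enc A} {eB : Enc B} {eC : Enc C}
  {eD : Enc D} (f : A -> B -> C -> D) : Prop :=
  effective (fun p => f p.1.1 p.1.2 p.2).

Lemma computable_comp (f g : nat -> nat) :
  computable f -> computable g -> computable (fun n => f (g n)).
Proof. by move=> [c hf] [d hg]; exists (Comp c d) => n /=; exists (g n). Qed.

Lemma computable_pair (f g : nat -> nat) :
  computable f -> computable g -> computable (fun n => <| f n, g n |>).
Proof.
by move=> [c hf] [d hg]; exists (Pair c d) => n /=; exists (f n), (g n).
Qed.

Lemma computable_id : computable id.
Proof.
exists (Pair Fst Snd) => n /=; exists (Cantor.of_nat n).1, (Cantor.of_nat n).2.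
by split=> //; rewrite -surjective_pairing Cantor.cancel_to_of.
Qed.

Lemma computable_fst : computable (fun n => (Cantor.of_nat n).1).
Proof. by exists Fst. Qed.

Lemma computable_snd : computable (fun n => (Cantor.of_nat n).2).
Proof. by exists Snd. Qed.

Lemma computable_S : computable succn.
Proof. by exists Succ. Qed.

Lemma computable_const (b : nat) : computable (fun _ => b).
Proof.
elim: b => [|b [c hc]]; first by exists Zero.
by exists (Comp Succ c) => n /=; exists b.
Qed.

Lemma computable_iteri (n b : nat -> nat) (s : nat -> nat) :
  computable n -> computable s -> computable b ->
  computable (fun x => iteri (n x) (fun k u => s <| x, <| k, u |> |>) (b x)).
Proof.
move=> [cn hn] [cs hs] [cb hb]; have [ci hi] := computable_id.
exists (Comp (Prec cb cs) (Pair ci cn)) => x /=.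
exists <| x, n x |>; first by exists x, (n x).
rewrite Cantor.cancel_of_to /=; elim: (n x) => [|k IHk] //=.
by exists (iteri k (fun k u => s <| x, <| k, u |> |>) (b x)).
Qed.

Section Closure.
Context {A B C D E : Type} {eA : Enc A} {eB : Enc B} {eC : Enc C} {eD : Enc D}
  {eE : Enc E}.

Lemma eff_ext (f g : A -> B) : f =1 g -> effective g -> effective f.
Proof. by move=> fg [c hc h]; exists c => // x; rewrite fg. Qed.

(** Only the codes of the values matter, which makes constructors and decodings
    computable for free. *)
Lemma eff_recode (f : A -> B) (g : A -> C) : effective g ->
  (forall x, enc (f x) = enc (g x)) -> effective f.
Proof. by move=> [c hc h] hf; exists c => // x; rewrite hf. Qed.

Lemma eff_id : effective (fun x : A => x).
Proof. by exists id => //; exact: computable_id. Qed.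

Lemma eff_app1 (g : B -> C) : effective g ->
  forall f : A -> B, effective f -> effective (fun x => g (f x)).
Proof.
move=> [c hc hg] f [d hd hf]; exists (fun n => c (d n)) => [|x].
  exact: computable_comp.
by rewrite hf hg.
Qed.

Lemma eff_pair (f : A -> B) (g : A -> C) :
  effective f -> effective g -> effective (fun x => (f x, g x)).
Proof.
move=> [c hc hf] [d hd hg]; exists (fun n => <| c n, d n |>) => [|x].
  exact: computable_pair.
by rewrite hf hg.
Qed.

Lemma eff_fst (f : A -> B * C) : effective f -> effective (fun x => (f x).1).
Proof.
move=> [c hc hf]; exists (fun n => (Cantor.of_nat (c n)).1) => [|x].
  exact: computable_comp computable_fst hc.
by rewrite hf Cantor.cancel_of_to.
Qed.

Lemma eff_snd (f : A -> B * C) : effective f -> effective (fun x => (f x).2).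
Proof.
move=> [c hc hf]; exists (fun n => (Cantor.of_nat (c n)).2) => [|x].
  exact: computable_comp computable_snd hc.
by rewrite hf Cantor.cancel_of_to.
Qed.

Lemma eff_const (b : B) : effective (fun _ : A => b).
Proof. by exists (fun _ => enc b) => //; exact: computable_const. Qed.

Lemma eff_enc (f : A -> B) : effective f -> effective (fun x => enc (f x)).
Proof. by move=> [c hc hf]; exists c. Qed.

Lemma eff_S (f : A -> nat) : effective f -> effective (fun x => (f x).+1).
Proof.
move=> [c hc hf]; exists (fun n => (c n).+1) => [|x]; last by rewrite hf.
exact: computable_comp computable_S hc.
Qed.

Lemma eff_Some (f : A -> B) : effective f -> effective (fun x => Some (f x)).
Proof.
move=> [c hc hf]; exists (fun n => (c n).+1) => [|x]; last by rewrite hf.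
exact: computable_comp computable_S hc.
Qed.

(** Together with composition this is all of primitive recursion; the closure
    under arithmetic operations is obtained from it. *)
Lemma eff_iteri (n : A -> nat) (s : A -> nat -> B -> B) (b : A -> B) :
  effective n -> effective (fun q : A * (nat * B) => s q.1 q.2.1 q.2.2) -> effective b ->
  effective (fun x => iteri (n x) (s x) (b x)).
Proof.
move=> [cn hcn hn] [cs hcs hs] [cb hcb hb].
exists (fun x => iteri (cn x) (fun k u => cs <| x, <| k, u |> |>) (cb x)).
  exact: computable_iteri.
move=> x; have -> : cn (enc x) = n x by exact: hn.
rewrite hb; elim: (n x) => [|k IHk] //=.
by rewrite IHk; exact: (hs (x, (k, iteri k (s x) (b x)))).
Qed.

Lemma eff_case_option (o : A -> option B) (f : A -> B -> C) (g : A -> C) :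
  effective o -> effective (fun q : A * B => f q.1 q.2) -> effective g ->
  effective (fun x => match o x with Some y => f x y | None => g x end).
Proof.
move=> [co hco ho] [cf hcf hf] [cg hcg hg].
pose s n := cf <| (Cantor.of_nat n).1, (Cantor.of_nat (Cantor.of_nat n).2).1 |>.
exists (fun x => iteri (co x) (fun k u => s <| x, <| k, u |> |>) (cg x)).
  apply: computable_iteri => //; apply: computable_comp hcf _.
  apply: computable_pair computable_fst _.
  exact: computable_comp computable_fst computable_snd.
move=> x; rewrite ho hg; case: (o x) => [y|] //=.
by rewrite /s !Cantor.cancel_of_to; exact: (hf (x, y)).
Qed.
End Closure.

Section Closure2.
Context {A B C D E : Type} {eA : Enc A} {eB : Enc B} {eC : Enc C} {eD : Enc D}
  {eE : Enc E}.

Lemma eff_app2 (g : B -> C -> D) : effective2 g -> forall (f1 : A -> B) (f2 : A -> C),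
  effective f1 -> effective f2 -> effective (fun x => g (f1 x) (f2 x)).
Proof. by move=> hg f1 f2 h1 h2; exact: (eff_app1 hg (eff_pair h1 h2)). Qed.

Lemma eff_app3 (g : B -> C -> D -> E) : effective3 g ->
  forall (f1 : A -> B) (f2 : A -> C) (f3 : A -> D),
  effective f1 -> effective f2 -> effective f3 -> effective (fun x => g (f1 x) (f2 x) (f3 x)).
Proof.
move=> hg f1 f2 f3 h1 h2 h3.
exact: (eff_app1 hg (eff_pair (eff_pair h1 h2) h3)).
Qed.

Lemma eff_if (b : A -> bool) (f g : A -> B) : effective b -> effective f -> effective g ->
  effective (fun x => if b x then f x else g x).
Proof.
move=> hb hf hg; apply: (eff_ext
  (g := fun x => iteri (enc (b x)) (fun _ _ => f x) (g x))).
  by move=> x; case: (b x).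
apply: (eff_iteri (s := fun x _ _ => f x)) => //.
exact: eff_app1 hf _ (eff_fst eff_id).
Qed.
End Closure2.

Create HintDb effective.

(** The goals solved are of the form [effective (fun x => t)]; the shape of [t]
    selects the closure property to be applied. *)
Ltac eff_tac := unfold effective2, effective3; auto 100 with effective nocore.

Ltac eff_apply_hyp :=
  match goal with
  | H : effective ?f |- effective (fun x => ?f _) => apply (eff_app1 H)
  | H : effective2 ?f |- effective (fun x => ?f _ _) => apply (eff_app2 H)
  | H : effective3 ?f |- effective (fun x => ?f _ _ _) => apply (eff_app3 H)
  end.

(* [apply] may leave a function in eta-reduced form, which no pattern of the
   database matches. *)
Ltac eff_eta :=
  lazymatch goal with
  | |- effective (fun x => _) => fail
  | |- effective ?f => change (effective (fun x => f x))
  end.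

#[export] Hint Extern 1 (effective (fun x => x)) => apply eff_id : effective.
#[export] Hint Extern 1 (effective (fun x => fst _)) =>
  apply eff_fst : effective.
#[export] Hint Extern 1 (effective (fun x => snd _)) =>
  apply eff_snd : effective.
#[export] Hint Extern 1 (effective (fun x => (_, _))) =>
  apply eff_pair : effective.
#[export] Hint Extern 1 (effective (fun x => Some _)) =>
  apply eff_Some : effective.
#[export] Hint Extern 1 (effective (fun x => S _)) => apply eff_S : effective.
#[export] Hint Extern 1 (effective (fun x => enc _)) =>
  apply eff_enc : effective.
#[export] Hint Extern 1 (effective (fun x => if _ then _ else _)) =>
  apply eff_if : effective.
#[export] Hint Extern 1
  (effective (fun x => match _ with Some _ => _ | None => _ end)) =>
  apply eff_case_option : effective.
#[export] Hint Extern 1 (effective (fun x => iteri _ _ _)) =>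
  apply eff_iteri : effective.
#[export] Hint Extern 0 (effective (fun _ => ?c)) => apply eff_const : effective.
#[export] Hint Extern 2 (effective _) => eff_apply_hyp : effective.
#[export] Hint Extern 3 (effective _) => eff_eta : effective.

Lemma eff_add {A : Type} {eA : Enc A}
  (f g : A -> nat) : effective f -> effective g ->
  effective (fun x => f x + g x).
Proof.
move=> hf hg.
apply: (eff_ext (g := fun x => iteri (g x) (fun _ u => u.+1) (f x))).
  by move=> x; elim: (g x) => [|k IHk] /=; rewrite ?addn0 // addnS IHk.
eff_tac.
Qed.
#[export] Hint Extern 1 (effective (fun x => addn _ _)) =>
  apply eff_add : effective.

Lemma eff_pred {A : Type} {eA : Enc A}
  (f : A -> nat) : effective f -> effective (fun x => (f x).-1).
Proof.
move=> hf; apply: (eff_ext (g := fun x => iteri (f x) (fun k _ => k) 0)).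
  by move=> x; case: (f x).
eff_tac.
Qed.
#[export] Hint Extern 1 (effective (fun x => predn _)) =>
  apply eff_pred : effective.

Lemma eff_sub {A : Type} {eA : Enc A}
  (f g : A -> nat) : effective f -> effective g ->
  effective (fun x => f x - g x).
Proof.
move=> hf hg.
apply: (eff_ext (g := fun x => iteri (g x) (fun _ u => u.-1) (f x))).
  by move=> x; elim: (g x) => [|k IHk] /=; rewrite ?subn0 // subnS IHk.
eff_tac.
Qed.
#[export] Hint Extern 1 (effective (fun x => subn _ _)) =>
  apply eff_sub : effective.

Lemma eff_mul {A : Type} {eA : Enc A}
  (f g : A -> nat) : effective f -> effective g ->
  effective (fun x => f x * g x).
Proof.
move=> hf hg.
apply: (eff_ext (g := fun x => iteri (g x) (fun _ u => f x + u) 0)).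
  by move=> x; elim: (g x) => [|k IHk] /=; rewrite ?muln0 // mulnS IHk.
eff_tac.
Qed.
#[export] Hint Extern 1 (effective (fun x => muln _ _)) =>
  apply eff_mul : effective.

Lemma eff_exp {A : Type} {eA : Enc A}
  (f g : A -> nat) : effective f -> effective g ->
  effective (fun x => f x ^ g x).
Proof.
move=> hf hg.
apply: (eff_ext (g := fun x => iteri (g x) (fun _ u => f x * u) 1)).
  by move=> x; elim: (g x) => [|k IHk] //=; rewrite expnS IHk.
eff_tac.
Qed.
#[export] Hint Extern 1 (effective (fun x => expn _ _)) =>
  apply eff_exp : effective.

Lemma eff_double {A : Type} {eA : Enc A}
  (f : A -> nat) : effective f -> effective (fun x => (f x).*2).
Proof.
move=> hf; apply: (eff_ext (g := fun x => f x + f x)).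
  by move=> x; rewrite addnn.
eff_tac.
Qed.
#[export] Hint Extern 1 (effective (fun x => double _)) =>
  apply eff_double : effective.

Lemma eff_leq {A : Type} {eA : Enc A}
  (f g : A -> nat) : effective f -> effective g ->
  effective (fun x => f x <= g x).
Proof.
move=> hf hg.
apply: (eff_ext (g := fun x => iteri (f x - g x) (fun _ _ => false) true)).
  by move=> x; rewrite /leq; case: (f x - g x).
eff_tac.
Qed.
#[export] Hint Extern 1 (effective (fun x => leq _ _)) =>
  apply eff_leq : effective.

Lemma eff_negb {A : Type} {eA : Enc A}
  (f : A -> bool) : effective f -> effective (fun x => ~~ f x).
Proof.
move=> hf; exact: (eff_if hf (eff_const false) (eff_const true)).
Qed.
#[export] Hint Extern 1 (effective (fun x => negb _)) =>
  apply eff_negb : effective.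

Lemma eff_andb {A : Type} {eA : Enc A}
  (f g : A -> bool) : effective f -> effective g ->
  effective (fun x => f x && g x).
Proof.
move=> hf hg; exact: (eff_if hf hg (eff_const false)).
Qed.
#[export] Hint Extern 1 (effective (fun x => andb _ _)) =>
  apply eff_andb : effective.

Lemma eff_orb {A : Type} {eA : Enc A}
  (f g : A -> bool) : effective f -> effective g ->
  effective (fun x => f x || g x).
Proof.
move=> hf hg; exact: (eff_if hf (eff_const true) hg).
Qed.
#[export] Hint Extern 1 (effective (fun x => orb _ _)) =>
  apply eff_orb : effective.

Lemma eff_eqn {A : Type} {eA : Enc A}
  (f g : A -> nat) : effective f -> effective g ->
  effective (fun x => f x == g x).
Proof.
move=> hf hg; apply: (eff_ext (g := fun x => (f x <= g x) && (g x <= f x))).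
  by move=> x; rewrite eqn_leq.
eff_tac.
Qed.
#[export] Hint Extern 1 (effective (fun x => eq_op _ _)) =>
  apply eff_eqn : effective.

Lemma eff_eqs {A : Type} {eA : Enc A}
  (f g : A -> seq bool) : effective f -> effective g ->
  effective (fun x => f x == g x).
Proof.
move=> hf hg; apply: (eff_ext (g := fun x => enc (f x) == enc (g x))).
  by move=> x; rewrite (inj_eq enc_inj).
by apply: eff_eqn; apply: eff_enc.
Qed.
#[export] Hint Extern 1 (effective (fun x => eq_op _ _)) =>
  apply eff_eqs : effective.

Lemma eff_odd {A : Type} {eA : Enc A}
  (f : A -> nat) : effective f -> effective (fun x => odd (f x)).
Proof.
move=> hf; apply: (eff_ext (g := fun x => iteri (f x) (fun _ b => ~~ b) false)).
  by move=> x; elim: (f x) => [|k IHk] //=; rewrite IHk.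
eff_tac.
Qed.
#[export] Hint Extern 1 (effective (fun x => odd _)) =>
  apply eff_odd : effective.

Lemma eff_b2n {A : Type} {eA : Enc A}
  (f : A -> bool) : effective f -> effective (fun x => nat_of_bool (f x)).
Proof.
by move=> hf; exact: (eff_enc hf).
Qed.
#[export] Hint Extern 1 (effective (fun x => nat_of_bool _)) =>
  apply eff_b2n : effective.

(** Sums and bounded quantifiers over functions on [nat], because a body that
    depends on an ordinal is out of reach of first-order unification. *)
Definition bsum (n : nat) (F : nat -> nat) : nat := \sum_(j < n) F j.

Lemma eff_sum {A : Type} {eA : Enc A}
  (n : A -> nat) (F : A -> nat -> nat) : effective n ->
  effective (fun q : A * nat => F q.1 q.2) -> effective (fun x => bsum (n x) (F x)).
Proof.
move=> hn hF; have hF2 : effective2 F by [].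
apply: (eff_ext (g := fun x => iteri (n x) (fun k u => u + F x k) 0)).
  by move=> x; rewrite /bsum; elim: (n x) => [|k IHk] /=;
    rewrite ?big_ord0 // big_ord_recr IHk.
eff_tac.
Qed.
#[export] Hint Extern 1 (effective (fun x => bsum _ _)) =>
  apply eff_sum : effective.

Lemma eff_divn {A : Type} {eA : Enc A}
  (f g : A -> nat) : effective f -> effective g ->
  effective (fun x => f x %/ g x).
Proof.
move=> hf hg.
apply: (eff_ext (g := fun x =>
    if g x == 0 then 0 else bsum (f x) (fun j => j.+1 * g x <= f x))).
  move=> x; case: (eqVneq (g x) 0) => [-> | g0]; first by rewrite divn0.
  have h m : \sum_(j < m) (j.+1 * g x <= f x) = minn m (f x %/ g x).
    elim: m => [|m IHm]; first by rewrite big_ord0 min0n.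
    by rewrite big_ord_recr /= IHm -leq_divRL ?lt0n //; lia.
  by rewrite /bsum h; apply/esym/minn_idPr; exact: leq_div.
eff_tac.
Qed.
#[export] Hint Extern 1 (effective (fun x => divn _ _)) =>
  apply eff_divn : effective.

Definition bex (n : nat) (P : pred nat) : bool := iteri n (fun k u => P k || u) false.

Lemma bexP n (P : pred nat) : reflect (exists2 k, k < n & P k) (bex n P).
Proof.
apply: (iffP idP) => [|[k kn Pk]].
  elim: n => [|n IHn] //= /orP[Pn|/IHn[k kn Pk]]; first by exists n.
  by exists k => //; exact: ltnW.
elim: n kn => [|n IHn] //=; rewrite ltnS leq_eqVlt => /orP[/eqP<-|/IHn->].
  by rewrite Pk.
by rewrite orbT.
Qed.

Lemma eff_bex {A : Type} {eA : Enc A}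
  (n : A -> nat) (P : A -> nat -> bool) : effective n ->
  effective (fun q : A * nat => P q.1 q.2) -> effective (fun x => bex (n x) (P x)).
Proof.
move=> hn hP; have hP2 : effective2 P by [].
rewrite /bex; eff_tac.
Qed.
#[export] Hint Extern 1 (effective (fun x => bex _ _)) =>
  apply eff_bex : effective.

Lemma eff_cons {A : Type} {eA : Enc A} (b : A -> bool) (s : A -> seq bool) :
  effective b -> effective s -> effective (fun x => b x :: s x).
Proof.
move=> hb hs; have h : effective (fun x => (enc (s x)).*2 + (b x).+1) by eff_tac.
by apply: (eff_recode h) => x; rewrite {1}/enc /= addnS.
Qed.
#[export] Hint Extern 1 (effective (fun x => cons _ _)) =>
  apply eff_cons : effective.

Lemma eff_consn {A : Type} {eA : Enc A} (b : A -> nat) (s : A -> seq nat) :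
  effective b -> effective s -> effective (fun x => b x :: s x).
Proof.
move=> hb hs.
have h : effective (fun x => Some (b x, enc (s x))) by eff_tac.
exact: (eff_recode h).
Qed.
#[export] Hint Extern 1 (effective (fun x => cons _ _)) =>
  apply eff_consn : effective.

Lemma eff_of_nat {A : Type} {eA : Enc A} (f : A -> nat) :
  effective f -> effective (fun x => Cantor.of_nat (f x)).
Proof.
move=> hf; apply: (eff_recode hf) => x.
by rewrite {1}/enc /= -surjective_pairing Cantor.cancel_to_of.
Qed.
#[export] Hint Extern 1 (effective (fun x => Cantor.of_nat _)) =>
  apply eff_of_nat : effective.

Lemma eff_nth {A : Type} {eA : Enc A} (s : A -> seq nat) (i : A -> nat) :
  effective s -> effective i -> effective (fun x => nth 0 (s x) (i x)).
Proof.
move=> hs hi.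
apply: (eff_ext (g := fun x => (Cantor.of_nat
   (iteri (i x) (fun _ u => (Cantor.of_nat u.-1).2) (enc (s x))).-1).1)).
  move=> x; have -> : iteri (i x) (fun _ u => (Cantor.of_nat u.-1).2) (enc (s x)) =
                      enc (drop (i x) (s x)).
    elim: (i x) => [|k IHk] /=; first by rewrite drop0.
    rewrite IHk -[in RHS]add1n -drop_drop drop1; case: (drop k (s x)) => [|y l] //.
    by rewrite {1}/enc /= Cantor.cancel_of_to.
  rewrite -[X in nth 0 (s x) X]addn0 -nth_drop.
  by case: (drop (i x) (s x)) => [|y l] //; rewrite {1}/enc /= Cantor.cancel_of_to.
eff_tac.
Qed.
#[export] Hint Extern 1 (effective (fun x => nth _ _ _)) =>
  apply eff_nth : effective.

Definition bits (m v : nat) : seq bool :=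
  iteri m (fun k u => odd (v %/ 2 ^ k) :: u) [::].

Lemma eff_bits {A : Type} {eA : Enc A} (m v : A -> nat) :
  effective m -> effective v -> effective (fun x => bits (m x) (v x)).
Proof. by move=> hm hv; rewrite /bits; eff_tac. Qed.
#[export] Hint Extern 1 (effective (fun x => bits _ _)) =>
  apply eff_bits : effective.

Lemma str_code_size s : 2 ^ size s <= (str_code s).+1 < 2 ^ (size s).+1.
Proof.
elim: s => [|b s IHs] //=; move: IHs; rewrite !expnS.
by case: b => /=; lia.
Qed.

(** As [str_code s + 1] lies between [2 ^ size s] and [2 ^ (size s + 1)], the
    length is the number of powers of two that fit below it. *)
Lemma eff_size {A : Type} {eA : Enc A} (s : A -> seq bool) :
  effective s -> effective (fun x => size (s x)).
Proof.
move=> hs.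
apply: (eff_ext (g := fun x => bsum (enc (s x)) (fun j => 2 ^ j.+1 <= (enc (s x)).+1))).
  move=> x; set t := s x; have /andP[h1 h2] := str_code_size t.
  have h m : \sum_(j < m) (2 ^ j.+1 <= (enc t).+1) = minn m (size t).
    elim: m => [|m IHm]; first by rewrite big_ord0 min0n.
    rewrite big_ord_recr /= IHm; case: (ltnP m (size t)) => hm.
      have -> : 2 ^ m.+1 <= (str_code t).+1 by apply: leq_trans h1; rewrite leq_exp2l.
      by lia.
    have -> : 2 ^ m.+1 <= (str_code t).+1 = false.
      by apply/negbTE; rewrite -ltnNge; apply: leq_trans h2 _; rewrite leq_exp2l.
    by lia.
  rewrite /bsum h; apply/esym/minn_idPr.
  by have := ltn_expl (size t) (isT : 1 < 2); rewrite -ltnS /=; move: h1; rewrite /enc /=; lia.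
eff_tac.
Qed.
#[export] Hint Extern 1 (effective (fun x => size _)) =>
  apply eff_size : effective.

Lemma eff_ncons {A : Type} {eA : Enc A}
  (n : A -> nat) (b : bool) (s : A -> seq bool) :
  effective n -> effective s -> effective (fun x => ncons (n x) b (s x)).
Proof.
move=> hn hs.
apply: (eff_ext (g := fun x => iteri (n x) (fun _ u => b :: u) (s x))).
  by move=> x; rewrite /ncons; elim: (n x) => [|k IHk] //=; rewrite IHk.
eff_tac.
Qed.
#[export] Hint Extern 1 (effective (fun x => ncons _ _ _)) =>
  apply eff_ncons : effective.

(** * Machines and computable enumerations of their graphs *)

(** [T n w] is the result of running [c] on [n] for [w] steps; the meaning of a
    step is immaterial as long as larger bounds preserve results. *)
Definition approximates (c : code) (T : nat -> nat -> option nat) : Prop :=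
  (forall n w w' m, w <= w' -> T n w = Some m -> T n w' = Some m) /\
  (forall n m, eval c n m <-> exists w, T n w = Some m).

Definition bfind (n : nat) (P : pred nat) : option nat :=
  iteri n (fun k u => if P k then Some k else u) None.

Lemma bfind_sound n P k : bfind n P = Some k -> k < n /\ P k.
Proof.
elim: n => [|n IHn] //=; rewrite /bfind /=; case: ifP => [Pn [<-]|_ /IHn[kn Pk]] //.
by split=> //; exact: ltnW.
Qed.

Lemma bfind_complete n (P : pred nat) k : k < n -> P k ->
  (forall j, P j -> j = k) -> bfind n P = Some k.
Proof.
move=> kn Pk uniqP; elim: n kn => [|n IHn] //.
rewrite ltnS leq_eqVlt /bfind /= => /orP[/eqP<-|/IHn]; first by rewrite Pk.
by case: ifP => // /uniqP <-.
Qed.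

Lemma eff_bfind {A : Type} {eA : Enc A} (n : A -> nat) (P : A -> nat -> bool) :
  effective n -> effective2 P -> effective (fun x => bfind (n x) (P x)).
Proof. by move=> hn hP; rewrite /bfind; eff_tac. Qed.

(** The stopping condition of an unbounded search when the function searched is
    known only in part: the code of an option is [0] if the value is missing and [1]
    if the value is [0]. *)
Definition mu_stop (F : nat -> option nat) (k : nat) : bool :=
  (enc (F k) == 1) && ~~ bex k (fun j => enc (F j) <= 1).

Lemma mu_stopP F k : reflect
  (F k = Some 0 /\ forall j, j < k -> exists v, F j = Some v.+1) (mu_stop F k).
Proof.
apply: (iffP andP) => [[h1 h2]|[h1 h2]]; split.
- by move: h1; rewrite /enc /=; case: (F k) => [[|v]|].
- move=> j jk; move/bexP: h2 => h2.
  case e: (F j) => [[|v]|]; [case: h2..|by exists v|case: h2].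
  + by exists j => //; rewrite e.
  + by exists j => //; rewrite e.
- by rewrite h1.
- by apply/bexP => -[j /h2[v ->]].
Qed.

Lemma mu_stop_mono F F' k : (forall j m, F j = Some m -> F' j = Some m) ->
  mu_stop F k -> mu_stop F' k.
Proof.
move=> FF' /mu_stopP[h1 h2]; apply/mu_stopP; split; first exact: FF'.
by move=> j /h2[v /FF' e]; exists v.
Qed.

Lemma mu_stop_uniq F k k' : mu_stop F k -> mu_stop F k' -> k = k'.
Proof.
move=> /mu_stopP[e h] /mu_stopP[e' h'].
case: (ltngtP k k') => // [/h'|/h] [v]; first by rewrite e.
by rewrite e'.
Qed.

Lemma common_stage (Q : nat -> nat -> Prop) k :
  (forall j w w', w <= w' -> Q j w -> Q j w') ->
  (forall j, j < k -> exists w, Q j w) -> exists w, forall j, j < k -> Q j w.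
Proof.
move=> mono; elim: k => [|k IHk] h; first by exists 0.
have [j jk|w hw] := IHk.
  by apply: h; exact: ltnW.
have [w' hw'] := h k (ltnSn k).
exists (maxn w w') => j; rewrite ltnS leq_eqVlt => /orP[/eqP->|jk].
  exact: mono (leq_maxr _ _) hw'.
exact: mono (leq_maxl _ _) (hw _ jk).
Qed.

Definition prec_stage (F G : nat -> nat -> option nat) (a k w : nat) : option nat :=
  iteri k (fun j u => if u is Some v then G (enc (a, (j, v))) w else None) (F a w).

Definition mu_stage (F : nat -> nat -> option nat) (n w : nat) : option nat :=
  bfind w (mu_stop (fun k => F (enc (n, k)) w)).

(** A step-bounded evaluator exists for each single code, by recursion on the
    code; the evaluator of a search looks at the first [w] values only. *)
Lemma approximable c : exists2 T, effective2 T & approximates c T.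
Proof.
elim: c => [| | | |f [F eF [mF hF]] g [G eG [mG hG]]|f [F eF [mF hF]] g [G eG [mG hG]]
  |f [F eF [mF hF]] g [G eG [mG hG]]|f [F eF [mF hF]]].
- exists (fun _ _ => Some 0); first by eff_tac.
  by split=> // n m; split=> [->|[w [<-]]] //; exists 0.
- exists (fun n _ => Some n.+1); first by eff_tac.
  by split=> // n m; split=> [->|[w [<-]]] //; exists 0.
- exists (fun n _ => Some (Cantor.of_nat n).1); first by eff_tac.
  by split=> // n m; split=> [->|[w [<-]]] //; exists 0.
- exists (fun n _ => Some (Cantor.of_nat n).2); first by eff_tac.
  by split=> // n m; split=> [->|[w [<-]]] //; exists 0.
- exists (fun n w => match F n w with Some a =>
    match G n w with Some b => Some (enc (a, b)) | None => None end | None => None end).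
    by eff_tac.
  split=> [n w w' m ww'|n m].
    case eF1: (F n w) => [a|] //; case eG1: (G n w) => [b|] // -[<-].
    by rewrite (mF _ _ _ _ ww' eF1) (mG _ _ _ _ ww' eG1).
  split=> [/= [a [b [/hF[w1 e1] /hG[w2 e2] ->]]]|[w]].
    exists (maxn w1 w2).
    by rewrite (mF _ _ _ _ (leq_maxl _ _) e1) (mG _ _ _ _ (leq_maxr _ _) e2).
  case eF1: (F n w) => [a|] //; case eG1: (G n w) => [b|] // -[<-] /=.
  by exists a, b; split=> //; [apply/hF|apply/hG]; exists w.
- exists (fun n w => match G n w with Some b => F b w | None => None end).
    by eff_tac.
  split=> [n w w' m ww'|n m].
    case eG1: (G n w) => [b|] // eF1.
    by rewrite (mG _ _ _ _ ww' eG1) (mF _ _ _ _ ww' eF1).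
  split=> [/= [b /hG[w1 e1] /hF[w2 e2]]|[w]].
    exists (maxn w1 w2).
    by rewrite (mG _ _ _ _ (leq_maxl _ _) e1) (mF _ _ _ _ (leq_maxr _ _) e2).
  case eG1: (G n w) => [b|] // e /=.
  by exists b; [apply/hG|apply/hF]; exists w.
- pose T := prec_stage F G.
  have mT a k w w' m : w <= w' -> T a k w = Some m -> T a k w' = Some m.
    move=> ww'; elim: k m => [|k IHk] m /=; first exact: mF.
    by case e: (T a k w) => [u|] //= /mG; rewrite (IHk _ e); exact.
  exists (fun n w => T (Cantor.of_nat n).1 (Cantor.of_nat n).2 w).
    by rewrite /effective2 /T /prec_stage; eff_tac.
  split=> [n w w' m|n m]; first exact: mT.
  rewrite /=; move: (Cantor.of_nat n) => [a k] /=; elim: k m => [|k IHk] m /=; first exact: hF.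
  split=> [[u /IHk[w1 e1] /hG[w2 e2]]|[w]].
    exists (maxn w1 w2).
    by rewrite (mT _ _ _ _ _ (leq_maxl _ _) e1) (mG _ _ _ _ (leq_maxr _ _) e2).
  by case e: (T a k w) => [u|] //= e'; exists u; [apply/IHk|apply/hG]; exists w.
- pose T := mu_stage F.
  exists T.
    have eS : effective2 (fun p : nat * nat => mu_stop (fun k => F (enc (p.1, k)) p.2)).
      by rewrite /mu_stop /effective2; eff_tac.
    rewrite /effective2 /T /mu_stage.
    apply: (eff_bfind
      (P := fun p : nat * nat => mu_stop (fun k => F (enc (p.1, k)) p.2))) => //.
    by eff_tac.
  have TP n w m : T n w = Some m <-> m < w /\ mu_stop (fun k => F (enc (n, k)) w) m.
    split=> [/bfind_sound//|[mw h]]; apply: bfind_complete => // j hj.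
    exact: mu_stop_uniq hj h.
  split=> [n w w' m ww' /TP[mw h]|n m].
    apply/TP; split; first exact: leq_trans mw ww'.
    by apply: mu_stop_mono h => j v; exact: mF.
  split=> [/= [/hF[w0 e0] h]|[w /TP[mw /mu_stopP[e h]]] /=].
    have [||w1 h1] := @common_stage (fun j w => exists v, F (enc (n, j)) w = Some v.+1) m.
    + by move=> j w w' ww' [v e]; exists v; exact: mF ww' e.
    + by move=> j /h[v /hF[w e]]; exists w, v.
    exists (maxn m.+1 (maxn w0 w1)); apply/TP; split; first by rewrite leq_max ltnSn.
    apply/mu_stopP; split; first by apply: mF e0; lia.
    by move=> j /h1[v e]; exists v; apply: mF e; lia.
  split; first by apply/hF; exists w.
  by move=> i /h[v e']; exists v; apply/hF; exists w.
Qed.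

Lemma eval_det c n m m' : eval c n m -> eval c n m' -> m = m'.
Proof.
have [T _ [mono h]] := approximable c => /h[w e] /h[w' e'].
have := mono _ _ _ _ (leq_maxl w w') e.
by rewrite (mono _ _ _ _ (leq_maxr w w') e') => -[].
Qed.

Lemma str_code_onto n : exists s, str_code s == n.
Proof.
elim/ltn_ind: n => -[|n] IHn; first by exists [::].
have [|s /eqP hs] := IHn n./2; first by lia.
by exists (odd n :: s) => /=; rewrite hs -{3}(odd_double_half n) addnC.
Qed.

Definition str_decode (n : nat) : seq bool := xchoose (str_code_onto n).

Lemma str_decodeK n : str_code (str_decode n) = n.
Proof. exact/eqP/(xchooseP (str_code_onto n)). Qed.

Lemma str_codeK s : str_decode (str_code s) = s.
Proof. by apply: str_code_inj; rewrite str_decodeK. Qed.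

Lemma eff_str_decode {A : Type} {eA : Enc A} (f : A -> nat) :
  effective f -> effective (fun x => str_decode (f x)).
Proof. by move=> hf; apply: (eff_recode hf) => x; exact: str_decodeK. Qed.

#[export] Hint Extern 1 (effective (fun x => str_decode _)) =>
  apply eff_str_decode : effective.

Definition enumerates {T : Type} (g : nat -> option T) (P : T -> Prop) : Prop :=
  forall x, P x <-> exists w, g w = Some x.

Definition graph (M : seq bool -> option (seq bool)) (p : seq bool * seq bool) : Prop :=
  M p.1 = Some p.2.

Lemma graph_enumerable M : partial_computable M ->
  exists2 g, effective g & enumerates g (graph M).
Proof.
move=> [c hc]; have [T eT [mono h]] := approximable c.
exists (fun w => match T (Cantor.of_nat w).1 (Cantor.of_nat w).2 with
  | Some m => Some (str_decode (Cantor.of_nat w).1, str_decode m) | None => None end).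
  by eff_tac.
move=> [s t]; rewrite /graph /= hc h; split=> [[w e]|[w]].
  by exists <| str_code s, w |>; rewrite !Cantor.cancel_of_to /= e !str_codeK.
case: (Cantor.of_nat w) => n w' /=; case e: (T n w') => [m|] // [<- <-].
by exists w'; rewrite !str_decodeK.
Qed.

(** The machine read off an enumeration [g] searches for the first [w] at which
    this function vanishes at [<|str_code s, w|>], that is, at which [g] lists a pair with
    first component [s]. *)
Definition mismatch (g : nat -> option (seq bool * seq bool)) (n : nat) : nat :=
  if g (Cantor.of_nat n).2 is Some p
  then nat_of_bool (enc p.1 != (Cantor.of_nat n).1) else 1.

Definition output_code (g : nat -> option (seq bool * seq bool)) (w : nat) : nat :=
  if g w is Some p then enc p.2 else 0.

(** Prefix-freeness of the listed pairs includes single-valuedness, as a string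
    is a prefix of itself.  This is how all machines below are obtained: it suffices
    to list their graphs. *)
Lemma machine_of_enumeration (g : nat -> option (seq bool * seq bool)) :
  effective g ->
  (forall w w' p q, g w = Some p -> g w' = Some q -> prefix p.1 q.1 -> p = q) ->
  exists2 M, prefix_free_machine M & enumerates g (graph M).
Proof.
move=> eg pfg.
pose F := mismatch g.
have [cF hF] : computable F.
  have [F' cF' hF'] : effective F by rewrite /F /mismatch; eff_tac.
  by case: cF' => c hc; exists c => n; rewrite -[F n]hF'.
pose out := output_code g.
have [cO hO] : computable out.
  have [out' cout' hout'] : effective out by rewrite /out /output_code; eff_tac.
  by case: cout' => c hc; exists c => n; rewrite -[out n]hout'.
pose c := Comp cO (Mu cF).
have F0 s w : F <| str_code s, w |> = 0 <-> exists t, g w = Some (s, t).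
  rewrite /F /mismatch Cantor.cancel_of_to /=; case: (g w) => [[s' t]|]; last first.
    by split=> // -[].
  rewrite /=; case: eqP => [/str_code_inj<-|ne]; split=> //; first by exists t.
  by move=> [t' [e _]]; case: ne; rewrite e.
have c_spec s t : (exists w, g w = Some (s, t)) <-> eval c (str_code s) (str_code t).
  split=> [[w e]|[w [h0 _] h]].
    have exw : exists w, F <| str_code s, w |> == 0 by exists w; apply/eqP/F0; exists t.
    case: (ex_minnP exw) => k /eqP hk kmin.
    have [t' ek] := (F0 _ _).1 hk.
    have [et] := pfg _ _ _ _ e ek (prefix_refl _).
    exists k; last by move: (hO k); rewrite /out /output_code ek -et.
    split; first by rewrite -hk; exact: hF.
    move=> i ik; exists (F <| str_code s, i |>).-1; rewrite prednK //.
    by rewrite lt0n; apply/negP => /kmin; rewrite leqNgt ik.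
  have [t' e] := (F0 s w).1 (eval_det (hF _) h0).
  exists w; rewrite e; congr (Some (_, _)).
  by apply: str_code_inj; have := eval_det h (hO w); rewrite /out /output_code e.
pose M s := if pselect (exists t, exists w, g w = Some (s, t)) is left ex
            then Some (projT1 (cid ex)) else None.
have M_spec s t : M s = Some t <-> exists w, g w = Some (s, t).
  rewrite /M; case: pselect => [ex|nex]; last first.
    by split=> // h; case: nex; exists t.
  case: cid => t' /= [w' e']; split=> [[<-]|[w e]]; first by exists w'.
  by have [->] := pfg _ _ _ _ e e' (prefix_refl _).
exists M; last by move=> [s t]; exact: M_spec.
split; first by exists c => s t; rewrite M_spec.
move=> s s' /=; case e: (M s) => [t|] // _; case e': (M s') => [t'|] // _ ss'.
move/M_spec: e => [w e]; move/M_spec: e' => [w' e'].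
by have [] := pfg _ _ _ _ e e' ss'.
Qed.

Lemma K_le M s t : M t = Some s -> exists2 n, K M s = Some n & n <= size t.
Proof.
move=> e; rewrite /K; case: pselect => [ex|nex]; last first.
  by case: nex; exists (size t); apply/asboolP; exists t.
case: ex_minnP => n _ nmin; exists n => //; apply: nmin.
by apply/asboolP; exists t.
Qed.

Lemma K_attained M s n : K M s = Some n -> exists2 t, size t = n & M t = Some s.
Proof.
rewrite /K; case: pselect => // ex [<-]; case: ex_minnP => k /asboolP hk _.
exact: hk.
Qed.

(** * Strings as dyadic rationals, left-c.e. reals and left cuts *)

(** [str_val s / 2 ^ size s] is the dyadic rational with binary expansion [s]. *)
Definition str_val (s : seq bool) : nat := foldl (fun v (b : bool) => v.*2 + b) 0 s.

Lemma str_val_rcons s b : str_val (rcons s b) = (str_val s).*2 + b.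
Proof. by rewrite /str_val foldl_rcons. Qed.

Lemma str_val_cat s t : str_val (s ++ t) = str_val s * 2 ^ size t + str_val t.
Proof.
elim/last_ind: t => [|t b IHt]; first by rewrite cats0 /= muln1 addn0.
by rewrite -rcons_cat !str_val_rcons IHt size_rcons expnS -!muln2; lia.
Qed.

Lemma str_val_cons b s : str_val (b :: s) = b * 2 ^ size s + str_val s.
Proof. by rewrite -cat1s str_val_cat. Qed.

Lemma str_val_lt s : str_val s < 2 ^ size s.
Proof.
elim/last_ind: s => [|s b IHs] //.
by rewrite str_val_rcons size_rcons expnS -!muln2; case: b; lia.
Qed.

Lemma str_val_inj s t : size s = size t -> str_val s = str_val t -> s = t.
Proof.
elim: s t => [|b s IHs] [|b' t] //= [est]; rewrite !str_val_cons est => e.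
have := str_val_lt t; have := str_val_lt s; rewrite est => hs ht.
have eb : b = b' by case: b e => /=; case: b' => //=; lia.
by rewrite eb; congr cons; apply: IHs => //; subst b'; lia.
Qed.

Lemma size_bits m v : size (bits m v) = m.
Proof. by rewrite /bits; elim: m => [|m IHm] //=; rewrite IHm. Qed.

Lemma str_val_bits m v : v < 2 ^ m -> str_val (bits m v) = v.
Proof.
have h : str_val (bits m v) = v %% 2 ^ m.
  elim: m => [|m IHm]; first by rewrite modn1.
  rewrite [bits _ _]/= -/(bits m v) str_val_cons size_bits IHm.
  rewrite expnS; have e : v %/ 2 ^ m = v %/ (2 * 2 ^ m) * 2 + odd (v %/ 2 ^ m).
    by rewrite [2 * _]mulnC divnMA divn2 muln2 addnC odd_double_half.
  have arith p q Q r r' b : q = Q * 2 + b -> v = q * p + r ->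
      v = Q * (2 * p) + r' -> b * p + r = r' by move=> ->; nia.
  exact: arith e (divn_eq _ _) (divn_eq _ _).
by move=> vm; rewrite h modn_small.
Qed.

Lemma str_valK s : bits (size s) (str_val s) = s.
Proof. by apply: str_val_inj; rewrite ?size_bits ?str_val_bits ?str_val_lt. Qed.

(** The dyadic interval of an extension is contained in that of the string. *)
Lemma prefix_str_val s t : prefix s t -> size s <= size t /\
  str_val s * 2 ^ (size t - size s) <= str_val t < (str_val s).+1 * 2 ^ (size t - size s).
Proof.
move=> /prefixP[u ->]; rewrite size_cat str_val_cat addKn leq_addr.
by split=> //; rewrite leq_addr mulSn addnC ltn_add2r str_val_lt.
Qed.

Lemma restrS x n : restr x n.+1 = rcons (restr x n) (x n).
Proof. by rewrite /restr mkseqS. Qed.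

Lemma size_restr x n : size (restr x n) = n.
Proof. exact: size_mkseq. Qed.

Lemma str_val_restrS x n : str_val (restr x n.+1) = (str_val (restr x n)).*2 + x n.
Proof. by rewrite restrS str_val_rcons. Qed.

Lemma restr_eq s x : s = restr x (size s) <-> str_val s = str_val (restr x (size s)).
Proof. by split=> [<-|e] //; apply: str_val_inj; rewrite ?size_restr. Qed.

Lemma lt_L_rcons s b x : lt_L (rcons s b) x <->
  lt_L s x \/ [/\ s = restr x (size s), b = false & x (size s) = true].
Proof.
split=> [[n [ns et en xn]]|[[n [ns et en xn]]|[es eb ex]]].
- move: ns; rewrite size_rcons ltnS leq_eqVlt => /orP[/eqP e|ns].
    right; subst n; move: et en; rewrite -cats1 take_size_cat // nth_cat ltnn subnn /=.
    by move=> <- ->.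
  left; exists n; split=> //; move: et en; rewrite -cats1.
    by rewrite takel_cat // ltnW.
  by rewrite nth_cat ns.
- exists n; rewrite size_rcons; split=> //; first by lia.
    by rewrite -cats1 takel_cat // ltnW.
  by rewrite -cats1 nth_cat ns.
- exists (size s); rewrite size_rcons; split=> //.
    by rewrite -cats1 take_size_cat.
  by rewrite -cats1 nth_cat ltnn subnn.
Qed.

Lemma lt_L_str_val s x : lt_L s x <-> str_val s < str_val (restr x (size s)).
Proof.
elim/last_ind: s => [|s b IHs]; first by split=> // -[n []].
rewrite lt_L_rcons IHs size_rcons str_val_restrS str_val_rcons.
split=> [[h|[/restr_eq h -> ->]]|]; [by case: b (x _) => -[]; lia|by lia|].
case: (ltngtP (str_val s) (str_val (restr x (size s)))) => h h'; [by left|exfalso|].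
  by move: h'; case: b (x _) => -[]; lia.
by right; move: h'; rewrite h; case: b (x _) => -[]; split=> //; try lia; exact/restr_eq.
Qed.

(** At equal lengths the lexicographic order is the order of the values. *)
Lemma le_L_str_val s x : le_L s x <-> str_val s <= str_val (restr x (size s)).
Proof.
rewrite /le_L lt_L_str_val restr_eq [in X in _ <-> X]leq_eqVlt.
by split=> [[h|h]|/orP[/eqP|]]; [rewrite h orbT|rewrite h eqxx|right|left].
Qed.

Lemma prefix_restr x n k : prefix (restr x n) (restr x (n + k)).
Proof.
apply/prefixP; elim: k => [|k [u hu]]; first by exists [::]; rewrite addn0 cats0.
by exists (rcons u (x (n + k))); rewrite addnS restrS hu rcons_cat.
Qed.

(** The two cases in which membership in the left cut is semidecidable for
    different reasons: an [x] that ends in zeros is a dyadic rational, and a string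
    belongs to the cut iff its value is at most that of [x]; in the other case
    ([le_L_left_approx]) the inequality is strict, hence witnessed by an
    approximation to [x]. *)
Lemma le_L_eventually0 x m s : (forall k, (m <= k) -> x k = false) ->
  le_L s x <-> (str_val s * 2 ^ m <= str_val (restr x m) * 2 ^ size s).
Proof.
move=> x0; rewrite le_L_str_val; set n := size s.
have e k : str_val (restr x (m + k)) = (str_val (restr x m) * 2 ^ k).
  elim: k => [|k IHk]; first by rewrite addn0 muln1.
  by rewrite addnS str_val_restrS IHk x0 ?leq_addr // expnS -muln2; lia.
have [_] := prefix_str_val (prefix_restr x n m).
rewrite !size_restr addKn addnC e; have := expn_gt0 2 m.
by move: (2 ^ m) (2 ^ n) => p q p0 /andP[h1 h2]; split=> h; nia.
Qed.

Definition zeros (n : nat) : seq bool := ncons n false [::].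

Lemma size_zeros n : size (zeros n) = n.
Proof. by rewrite size_ncons addn0. Qed.

Lemma le_L_zeros x n : le_L (zeros n) x.
Proof.
rewrite le_L_str_val; suff -> : str_val (zeros n) = 0 by [].
by elim: n => // n IHn; rewrite [zeros _]/= str_val_cons -/(zeros n) IHn.
Qed.

Section RealPart.
Local Open Scope classical_set_scope.
Local Open Scope ring_scope.
Variable R : realType.
Implicit Types (x : nat -> bool) (r : R).

Definition dyadic (v n : nat) : R := v%:R / 2 ^+ n.

Lemma dyadic_le v n w m : (dyadic v n <= dyadic w m) = (v * 2 ^ m <= w * 2 ^ n)%N.
Proof.
rewrite /dyadic ler_pdivrMr ?exprn_gt0 // mulrAC ler_pdivlMr ?exprn_gt0 //.
by rewrite -!natrX -!natrM ler_nat.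
Qed.

Lemma dyadic_lt v n w m : (dyadic v n < dyadic w m) = (v * 2 ^ m < w * 2 ^ n)%N.
Proof. by rewrite ltNge dyadic_le -ltnNge. Qed.

Lemma dyadicM v n k : dyadic (v * 2 ^ k) (n + k) = dyadic v n.
Proof. by apply/eqP; rewrite eq_le !dyadic_le expnD -!mulnA [(2 ^ k * _)%N]mulnC leqnn. Qed.

Lemma dyadicD v w n : dyadic (v + w) n = dyadic v n + dyadic w n.
Proof. by rewrite /dyadic natrD mulrDl. Qed.

Lemma small_pow2 (eps : R) : 0 < eps ->
  exists n0, forall n, (n0 <= n)%N -> dyadic 1 n <= eps.
Proof.
move=> eps0; have [n0 _ h] := near_infty_natSinv_expn_lt (PosNum eps0).
by exists n0 => n /h/ltW.
Qed.

Lemma series_bits x n :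
  series (fun k => (x k)%:R / 2 ^+ k.+1 : R) n = dyadic (str_val (restr x n)) n.
Proof.
elim: n => [|n IHn]; first by rewrite /series /= big_geq // /dyadic mul0r.
rewrite /series /= big_nat_recr //= -[X in X + _]/(series _ n) IHn /dyadic.
rewrite str_val_restrS natrD -muln2 natrM exprS.
by field; rewrite expf_neq0 //; lra.
Qed.

Lemma dyadic_restr_mono x n k :
  dyadic (str_val (restr x n)) n <= dyadic (str_val (restr x (n + k))) (n + k).
Proof.
rewrite dyadic_le; elim: k => [|k IHk]; first by rewrite addn0.
by rewrite addnS str_val_restrS expnS; lia.
Qed.

Lemma dyadic_restr_ub x n k :
  dyadic (str_val (restr x (n + k))).+1 (n + k) <= dyadic (str_val (restr x n)).+1 n.
Proof.
rewrite dyadic_le; elim: k => [|k IHk]; first by rewrite addn0.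
by rewrite addnS str_val_restrS expnS; case: (x _); lia.
Qed.

Lemma cvg_bits x : (fun n => dyadic (str_val (restr x n)) n) @ \oo --> binary_value R x.
Proof.
rewrite /binary_value.
have -> : series (fun k => (x k)%:R / 2 ^+ k.+1 : R) =
          (fun n => dyadic (str_val (restr x n)) n).
  by apply/funext => n; exact: series_bits.
apply: (@nondecreasing_is_cvgn R (fun n => dyadic (str_val (restr x n)) n)).
  by move=> m n mn; rewrite -(subnKC mn) dyadic_restr_mono.
exists 1 => _ [n _ <-]; have := dyadic_restr_ub x 0 n; rewrite add0n.
rewrite {2}/dyadic /= expr0 divr1; apply: le_trans.
by rewrite dyadic_le; lia.
Qed.

(** A real lies in the closed dyadic interval of each initial segment of its
    expansion, and at an end of it only if the remaining bits are constant. *)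
Lemma binary_value_ge x n : dyadic (str_val (restr x n)) n <= binary_value R x.
Proof.
apply: (cvgr_to_ge (@cvg_bits x)); near=> m.
have nm : (n <= m)%N by near: m; exact: nbhs_infty_ge.
by rewrite -(subnKC nm) dyadic_restr_mono.
Unshelve. all: by end_near.
Qed.

Lemma binary_value_le x n : binary_value R x <= dyadic (str_val (restr x n)).+1 n.
Proof.
apply: (cvgr_to_le (@cvg_bits x)); near=> m.
have nm : (n <= m)%N by near: m; exact: nbhs_infty_ge.
rewrite -(subnKC nm); apply: le_trans (dyadic_restr_ub x n (m - n)).
by rewrite dyadic_le leq_mul2r leqnSn orbT.
Unshelve. all: by end_near.
Qed.

Lemma binary_value_gt x n k : (n <= k)%N -> x k ->
  dyadic (str_val (restr x n)) n < binary_value R x.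
Proof.
move=> nk xk; apply: le_lt_trans (dyadic_restr_mono x n (k - n)) _.
rewrite subnKC //; apply: lt_le_trans (binary_value_ge x k.+1).
by rewrite dyadic_lt str_val_restrS xk expnS; have := expn_gt0 2 k; lia.
Qed.

Lemma binary_value_lt x n k : (n <= k)%N -> x k = false ->
  binary_value R x < dyadic (str_val (restr x n)).+1 n.
Proof.
move=> nk xk; apply: lt_le_trans (dyadic_restr_ub x n (k - n)).
rewrite subnKC //; apply: le_lt_trans (binary_value_le x k.+1) _.
by rewrite dyadic_lt str_val_restrS xk expnS; have := expn_gt0 2 k; lia.
Qed.

Lemma binary_value_ge0 x : 0 <= binary_value R x.
Proof. by apply: le_trans (binary_value_ge x 0); rewrite /dyadic mul0r. Qed.

(** The approximations to a left-c.e. real may be taken dyadic, with denominator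
    [2 ^ s] at stage [s]; all later computations are then in integers. *)
Definition left_approx (N : nat -> nat) (r : R) : Prop :=
  [/\ effective N, forall s, ((N s).*2 <= N s.+1)%N, forall s, dyadic (N s) s <= r &
      forall r', r' < r -> exists s, r' < dyadic (N s) s].

Lemma effective_computable (f : nat -> nat) : computable f -> effective f.
Proof. by move=> cf; exists f. Qed.

(** Round down the rational approximations, after replacing negative ones by
    [0].  Monotonicity survives because the grids are nested. *)
Lemma left_ce_approx r : 0 <= r -> left_ce r -> exists N, left_approx N r.
Proof.
move=> r0 [q [[sg [p [d [/effective_computable csg /effective_computable cp
  /effective_computable cd hq]]]] qmono qr]].
pose N s := (if odd (sg s) then 0 else (p s * 2 ^ s) %/ (d s).+1)%N.
pose Q s : R := Num.max 0 (ratr (q s)).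
have Qmono m n : (m <= n)%N -> Q m <= Q n.
  move=> mn; rewrite /Q ge_max !le_max lexx /= ler_rat qmono ?orbT //.
have NQ s : (N s)%:R <= Q s * 2 ^+ s < (N s).+1%:R.
  rewrite /Q hq /N; case: (boolP (odd (sg s))) => osg.
    have -> : Num.max 0 (ratr ((-1) ^+ sg s * (p s)%:R / (d s).+1%:R)) = 0 :> R.
      apply/max_idPl; rewrite -signr_odd osg expr1 mulN1r mulNr rmorphN oppr_le0.
      by rewrite ler0q divr_ge0.
    by rewrite mul0r lexx ltr01.
  rewrite -signr_odd (negbTE osg) expr0 mul1r fmorph_div /= !ratr_nat.
  have -> : Num.max 0 ((p s)%:R / (d s).+1%:R : R) = (p s)%:R / (d s).+1%:R.
    by apply/max_idPr; rewrite divr_ge0.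
  rewrite mulrAC ler_pdivlMr ?ltr0n // ltr_pdivrMr ?ltr0n // -!natrX -!natrM.
  by rewrite ler_nat ltr_nat -leq_divRL // -ltn_divLR // leqnn ltnSn.
have qr_le m : ratr (q m) <= r.
  apply: (cvgr_to_ge qr); near=> n; rewrite ler_rat qmono //.
  by near: n; exact: nbhs_infty_ge.
have Qr m : Q m <= r by rewrite /Q ge_max r0 qr_le.
exists N; split.
- by rewrite /N; eff_tac.
- move=> s; rewrite -ltnS -(ltr_nat R); have /andP[h1 _] := NQ s.
  have /andP[_] := NQ s.+1; apply: le_lt_trans.
  rewrite -muln2 natrM exprSr mulrA ler_pM2r //; apply: le_trans h1 _.
  by rewrite ler_pM2r ?exprn_gt0 // Qmono.
- move=> s; have /andP[h1 _] := NQ s; apply: le_trans (Qr s).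
  by rewrite /dyadic ler_pdivrMr // exprn_gt0.
move=> r' rr'; have e0 : 0 < (r - r') / 2 by rewrite divr_gt0 // subr_gt0.
near \oo => s; exists s.
have h1 : r' + (r - r') / 2 < ratr (q s).
  near: s; apply: (cvgr_gt r qr).
  by lra.
have h2 : 2^-1 ^+ s < (r - r') / 2.
  rewrite exprVn -div1r; near: s; exact: (near_infty_natSinv_expn_lt (PosNum e0)).
rewrite /dyadic ltr_pdivlMr ?exprn_gt0 //.
have /andP[_] := NQ s; rewrite -addn1 natrD; move: h2.
have h3 : ratr (q s) <= Q s by rewrite /Q le_max lexx orbT.
have p0 : 0 < 2 ^+ s :> R by rewrite exprn_gt0.
rewrite exprVn -(ltr_pM2r p0) mulVf ?gt_eqF // => h2 h4.
by have : r' * 2 ^+ s + (r - r') / 2 * 2 ^+ s < Q s * 2 ^+ s;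
  [rewrite -mulrDl ltr_pM2r // (lt_le_trans h1)|lra].
Unshelve. all: by end_near.
Qed.

Lemma le_L_left_approx x N s : (forall m, exists2 k, (m <= k)%N & x k) ->
  left_approx N (binary_value R x) ->
  le_L s x <-> exists w, (str_val s * 2 ^ w < N w * 2 ^ size s)%N.
Proof.
move=> x1 [_ _ leN supN]; rewrite le_L_str_val; set n := size s.
split=> [h|[w]].
  have [k nk xk] := x1 n.
  have [|w] := supN (dyadic (str_val s) n); last by rewrite dyadic_lt; exists w.
  apply: le_lt_trans (binary_value_gt nk xk).
  by rewrite dyadic_le leq_mul2r h orbT.
rewrite -dyadic_lt => h.
have := lt_le_trans (lt_le_trans h (leN w)) (binary_value_le x n).
by rewrite dyadic_lt ltn_pmul2r ?expn_gt0.
Qed.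

Lemma cut_enumerable x : left_ce (binary_value R x) ->
  exists2 g, effective g & enumerates g (fun s => le_L s x).
Proof.
have enumP (D : nat -> nat -> nat -> bool) :
    effective3 D -> (forall s, le_L s x <-> exists w, D (size s) (str_val s) w) ->
    exists2 g, effective g & enumerates g (fun s => le_L s x).
  move=> eD hD.
  exists (fun w => let n := (Cantor.of_nat w).1 in
    let v := (Cantor.of_nat (Cantor.of_nat w).2).1 in
    if (v < 2 ^ n)%N && D n v (Cantor.of_nat (Cantor.of_nat w).2).2
    then Some (bits n v) else None); first by rewrite /=; eff_tac.
  move=> s; rewrite hD; split=> [[w h]|[w]].
    exists <| size s, <| str_val s, w |> |>.
    by do ?[rewrite Cantor.cancel_of_to /=]; rewrite h str_val_lt str_valK.
  rewrite /=; case: ifP => // /andP[h1 h2] [<-].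
  by rewrite size_bits str_val_bits //; eexists; exact: h2.
move=> /(left_ce_approx (binary_value_ge0 x))[N hN].
case: (pselect (exists m, forall k, (m <= k)%N -> x k = false)) => [[m x0]|nx0].
  apply: (enumP (fun n v _ => v * 2 ^ m <= str_val (restr x m) * 2 ^ n)%N).
    by eff_tac.
  by move=> s; rewrite (le_L_eventually0 s x0); split=> [h|[]//]; exists 0%N.
apply: (enumP (fun n v w => v * 2 ^ w < N w * 2 ^ n)%N).
  by case: hN => eN _ _ _; eff_tac.
move=> s; apply: le_L_left_approx hN => m; apply: contrapT => h.
by case: nx0; exists m => k mk; apply/negbTE/negP => xk; case: h; exists k.
Qed.
End RealPart.

(** * Following the approximation of a left-c.e. real *)

(** Skip every index at which a value is listed that has been listed before. *)
Lemma injective_enumeration {T : Type} {eT : Enc T} (g : nat -> option T) P :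
  effective g -> enumerates g P ->
  exists e, [/\ effective e, enumerates e P &
    forall i j x, e i = Some x -> e j = Some x -> i = j].
Proof.
move=> eg gP.
exists (fun w => if bex w (fun j => enc (g j) == enc (g w)) then None else g w).
split; first by eff_tac.
- move=> x; rewrite gP; split=> [ex|[w]]; last by case: ifP => // _; exists w.
  have ex' : exists w, enc (g w) == enc (Some x).
    by case: ex => w ew; exists w; rewrite ew.
  case: (ex_minnP ex') => w /eqP ew wmin; exists w; rewrite (enc_inj ew).
  by case: ifP => // /bexP[j jw /wmin]; rewrite leqNgt jw.
- move=> i j x; case: ifP => // /bexP hi ei; case: ifP => // /bexP hj ej.
  by case: (ltngtP i j) => // ij; [case: hj; exists i|case: hi; exists j];
    rewrite // ei ej.
Qed.

Lemma atoms_enumerable M (C : seq bool -> Prop) gC :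
  partial_computable M -> effective gC -> enumerates gC C ->
  exists e, [/\ effective e, enumerates e (fun p => M p.1 = Some p.2 /\ C p.2) &
    forall i j p, e i = Some p -> e j = Some p -> i = j].
Proof.
move=> /graph_enumerable[g eg hg] eC hC.
apply: (@injective_enumeration _ _ (fun w =>
  if g (Cantor.of_nat w).1 is Some p then
    if gC (Cantor.of_nat w).2 is Some s then
      if s == p.2 then Some p else None
    else None else None)); first by eff_tac.
move=> p; split=> [[/hg[w1 e1] /hC[w2 e2]]|[w]].
  by exists <| w1, w2 |>; rewrite Cantor.cancel_of_to /= e1 e2 eqxx.
case e1: (g _) => [q|] //; case e2: (gC _) => [s|] //; case: eqP => // es [<-].
by split; [apply/hg; eexists; exact: e1|apply/hC; rewrite -es; eexists; exact: e2].
Qed.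

Section Process.
Variables (N : nat -> nat) (e : nat -> option (seq bool * seq bool)).

(** The condition for moving on to the next atom at stage [s + 1]. The state [q]
    holds the index of the current atom and the approximation at the last payment in
    units of [2 ^- s]; the increase that is waited for must be an integer multiple
    of the unit [2 ^- (s + 1)].  Indices that list no atom are free of charge. *)
Definition paid (c s : nat) (q : nat * nat) : bool :=
  if e q.1 is Some p then
    (c + size p.1 <= s.+1) && (q.2.*2 + 2 ^ (s.+1 - (c + size p.1)) <= N s.+1)
  else true.

Definition state (c s : nat) : nat * nat :=
  iteri s (fun s q => if paid c s q then (q.1.+1, N s.+1) else (q.1, q.2.*2)) (0, 0).

Definition idx c s := (state c s).1.
Definition acc c s := (state c s).2.
Definition fires c s := paid c s (state c s).

Hypothesis eN : effective N.
Hypothesis ee : effective e.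

Lemma eff_paid : effective3 paid.
Proof. by rewrite /effective3 /paid; eff_tac. Qed.

Lemma eff_state : effective2 state.
Proof. by have h := eff_paid; rewrite /effective2 /state; eff_tac. Qed.

Lemma idxS c s : idx c s.+1 = idx c s + fires c s.
Proof.
by rewrite /idx /fires [state c s.+1]/= -/(state c s); case: ifP; rewrite ?addn1 ?addn0.
Qed.

Lemma accS c s : acc c s.+1 = if fires c s then N s.+1 else (acc c s).*2.
Proof. by rewrite /acc /fires [state c s.+1]/= -/(state c s); case: ifP. Qed.

Hypothesis N2 : forall s, (N s).*2 <= N s.+1.

Lemma acc_le c s : acc c s <= N s.
Proof.
elim: s => [|s IHs] //; rewrite accS; case: ifP => // _.
by apply: leq_trans (N2 s); rewrite leq_double.
Qed.

Lemma acc_double c s : (acc c s).*2 <= acc c s.+1.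
Proof.
rewrite accS; case: ifP => // _; apply: leq_trans (N2 s).
by rewrite leq_double acc_le.
Qed.

Lemma acc_mono c s k : acc c s * 2 ^ k <= acc c (s + k).
Proof.
elim: k => [|k IHk]; first by rewrite muln1 addn0.
by rewrite addnS expnS; apply: leq_trans (acc_double _ _); lia.
Qed.

Lemma N_mono s k : N s * 2 ^ k <= N (s + k).
Proof.
elim: k => [|k IHk]; first by rewrite muln1 addn0.
by rewrite addnS expnS; apply: leq_trans (N2 _); lia.
Qed.

Lemma idx_mono c s k : idx c s <= idx c (s + k).
Proof.
elim: k => [|k IHk]; first by rewrite addn0.
by rewrite addnS idxS; apply: leq_trans IHk (leq_addr _ _).
Qed.

Lemma acc_idle c s k : idx c (s + k) = idx c s -> acc c (s + k) = acc c s * 2 ^ k.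
Proof.
elim: k => [|k IHk]; first by rewrite addn0 muln1.
rewrite addnS idxS accS => h; have := idx_mono c s k.
case: (fires c (s + k)) h => /= h hk; first by lia.
by rewrite IHk ?expnS; lia.
Qed.

Lemma idx_le c s : idx c s <= s.
Proof. by elim: s => [|s IHs] //; rewrite idxS; case: (fires c s); lia. Qed.

Lemma every_index_fires c : (forall s0, exists2 s, s0 <= s & fires c s) ->
  forall i, exists2 s, idx c s = i & fires c s.
Proof.
move=> unb.
have next s0 : exists2 s, idx c s = idx c s0 & fires c s.
  have ex : exists k, fires c (s0 + k).
    by have [s h f] := unb s0; exists (s - s0); rewrite subnKC.
  case: (ex_minnP ex) => k fk kmin; exists (s0 + k) => //.
  elim: k {fk} kmin => [|k IHk] kmin; first by rewrite addn0.
  rewrite addnS idxS IHk; last by move=> j /kmin; lia.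
  by case: (boolP (fires _ _)) => [/kmin|_]; rewrite ?ltnn // addn0.
elim=> [|i [s es fs]]; first exact: (next 0).
by have [s' es' fs'] := next s.+1; exists s' => //; rewrite es' idxS fs es addn1.
Qed.

Section Stuck.
Local Open Scope ring_scope.
Variables (R : realType) (a : R).
Hypothesis supN : forall r', r' < a -> exists s, r' < dyadic R (N s) s.

(** While no payment occurs, the accepted approximation does not move, and that
    of [a] stays short of the next payment at all stages at which this payment is a
    multiple of the unit. *)
Lemma stuck_bound c s0 : (forall s, (s0 <= s)%N -> ~~ fires c s) ->
  exists2 p, e (idx c s0) = Some p &
    a <= dyadic R (acc c s0) s0 + dyadic R 1 (c + size p.1).
Proof.
move=> stuck.
have idle k : idx c (s0 + k) = idx c s0.
  elim: k => [|k IHk]; first by rewrite addn0.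
  by rewrite addnS idxS (negbTE (stuck _ (leq_addr _ _))) addn0 IHk.
have := stuck _ (leqnn s0); rewrite /fires /paid -/(idx c s0).
case ep: (e _) => [p|] // _; exists p => //.
rewrite leNgt; apply/negP => /supN[w]; set l := (c + size p.1)%N => hw.
(* late enough for the approximation to exceed the bound, and for [2 ^- l] to be a
   multiple of the unit *)
pose k := (w + l)%N; have := stuck (s0 + k)%N (leq_addr _ _).
rewrite /fires /paid -/(idx c _) -/(acc c _) idle ep -/l acc_idle //.
have ls : (l <= (s0 + k).+1)%N by rewrite /k; lia.
rewrite ls /= -muln2 -mulnA -expnSr => /negP; apply.
rewrite -(leq_pmul2r (expn_gt0 2 (s0 + k).+1)) -(dyadic_le R) dyadicD -addnS dyadicM.
have -> : dyadic R (2 ^ (s0 + k.+1 - l)) (s0 + k.+1) = dyadic R 1 l.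
  rewrite -[RHS](dyadicM R 1 l (s0 + k.+1 - l)) mul1n subnKC //.
  by rewrite addnS.
apply: le_trans (ltW hw) _; have -> : (s0 + k.+1 = w + (s0 + l).+1)%N by rewrite /k; lia.
by rewrite -(dyadicM R (N w) w (s0 + l).+1) dyadic_le leq_mul2r N_mono orbT.
Qed.
End Stuck.
End Process.

(** * A random real lets every payment through *)

Lemma prefix_ncons r r' u v :
  prefix (ncons r true (false :: u)) (ncons r' true (false :: v)) ->
  r = r' /\ prefix u v.
Proof.
elim: r r' => [|r IHr] [|r'] //=.
by move=> /IHr[-> ].
Qed.

(** Randomness through an arbitrary machine: its descriptions of the initial
    segments of a random sequence save only boundedly many bits. *)
Lemma optimal_random_bound U M y : optimal U -> random_seq U y ->
  prefix_free_machine M ->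
  exists c, forall n t, M t = Some (restr y n) -> n <= size t + c.
Proof.
move=> [_ opt] [c1 hc1] /opt[c2 hc2]; exists (c2 + c1) => n t /K_le[k ek kt].
move: (hc2 (restr y n)) (hc1 n); rewrite ek; case: (K U _) => [l|] //=.
by lia.
Qed.

Section Reals.
Variable R : realType.

(** A real with value [1] has the expansion [1 1 1 ...], and the machine that
    sends [1^w 0] to [1^(2w)] describes the initial segments of this expansion with
    half their length. *)
Lemma binary_value_lt1 U y : optimal U -> random_seq U y ->
  (binary_value R y < 1)%R.
Proof.
move=> optU rndy.
case: (pselect (exists k, y k = false)) => [[k yk]|y1].
  apply: lt_le_trans (binary_value_lt R (leq0n k) yk) _.
  by rewrite /dyadic expr0 divr1.
have y1' k : y k by case e: (y k) => //; case: y1; exists k.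
have [] := @machine_of_enumeration
    (fun w => Some (ncons w true [:: false], ncons w.*2 true [::])).
- by eff_tac.
- by move=> w w' _ _ [<-] [<-] /= /prefix_ncons[->].
move=> M pfM hM; have [c hc] := optimal_random_bound optU rndy pfM.
(* [2 (c + 2)] bits described by [c + 3] *)
have := hc (c.+2).*2 (ncons c.+2 true [:: false]).
rewrite size_ncons /=; have -> : restr y (c.+2).*2 = ncons (c.+2).*2 true [::].
  apply: (@eq_from_nth _ false); rewrite size_restr ?size_ncons ?addn0 // => i i_lt.
  by rewrite nth_mkseq // nth_ncons i_lt y1'.
have : M (ncons c.+2 true [:: false]) = Some (ncons (c.+2).*2 true [::]).
  by apply/(hM (_, _)); exists c.+2.
by move=> -> /(_ erefl); lia.
Qed.

Section Compress.
Variables (U : seq bool -> option (seq bool)) (C : seq bool -> Prop).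
Variables (N : nat -> nat) (e : nat -> option (seq bool * seq bool)).
Hypothesis pfU : prefix_free_machine U.
Hypotheses (eN : effective N) (ee : effective e).
Hypothesis N2 : forall s, (N s).*2 <= N s.+1.
Hypothesis eP : enumerates e (fun p => U p.1 = Some p.2 /\ C p.2).
Hypothesis e_inj : forall i j p, e i = Some p -> e j = Some p -> i = j.

Lemma atom_prefix i j p q : e i = Some p -> e j = Some q -> prefix p.1 q.1 -> p = q.
Proof.
move=> ei ej pq.
have [Up _] : U p.1 = Some p.2 /\ C p.2 by apply/eP; exists i.
have [Uq _] : U q.1 = Some q.2 /\ C q.2 by apply/eP; exists j.
have e1 : p.1 = q.1 by apply: pfU.2 pq; rewrite /= ?Up ?Uq.
by move: Up Uq; case: p q e1 {ei ej pq} => [p1 p2] [q1 q2] /= -> -> [->].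
Qed.

(** The graph of the machine that turns a blocked payment into short
    descriptions.  Any stage [s] at which the [i]-th atom is the current one yields
    the same pair, because the approximation is frozen in between ([acc_ratio]).
    The two bits [odd b] and [odd b'] choose one of three adjacent strings. *)
Definition guess (w : nat) : option (seq bool * seq bool) :=
  let r := (Cantor.of_nat w).1 in
  let s := (Cantor.of_nat (Cantor.of_nat w).2).1 in
  let b := (Cantor.of_nat (Cantor.of_nat (Cantor.of_nat w).2).2).1 in
  let b' := (Cantor.of_nat (Cantor.of_nat (Cantor.of_nat w).2).2).2 in
  if e (idx N e r.*2 s) is Some p then
    let m := r.*2 + size p.1 in
    Some (ncons r true (false :: odd b :: odd b' :: p.1),
          bits m ((acc N e r.*2 s * 2 ^ m %/ 2 ^ s + (odd b + odd b')).-1))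
  else None.

Lemma eff_guess : effective guess.
Proof.
have es := eff_state eN ee.
have ei : effective2 (idx N e) by rewrite /effective2 /idx; eff_tac.
have ea : effective2 (acc N e) by rewrite /effective2 /acc; eff_tac.
by rewrite /guess; eff_tac.
Qed.

Lemma acc_ratio c s s' m : idx N e c s = idx N e c s' ->
  acc N e c s * 2 ^ m %/ 2 ^ s = acc N e c s' * 2 ^ m %/ 2 ^ s'.
Proof.
wlog ss' : s s' / s <= s' => [hwlog|].
  by case: (leqP s s') => [/hwlog//|/ltnW/hwlog h /esym/h].
rewrite -(subnKC ss') => /esym/acc_idle ->.
by rewrite expnD mulnAC divnMr ?expn_gt0.
Qed.

(** Prefix-freeness is inherited from [U], since the prefix [1^r 0] delimits
    itself and the two bits have a fixed position. *)
Lemma guess_prefix w w' p q : guess w = Some p -> guess w' = Some q ->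
  prefix p.1 q.1 -> p = q.
Proof.
rewrite /guess.
move: (Cantor.of_nat w) => [r w1] /=; move: (Cantor.of_nat w1) => [s w2] /=.
move: (Cantor.of_nat w2) => [b1 b2] /=.
move: (Cantor.of_nat w') => [r' w1'] /=; move: (Cantor.of_nat w1') => [s' w2'] /=.
move: (Cantor.of_nat w2') => [b1' b2'] /=.
case ei: (e _) => [x|] // [<-]; case ej: (e _) => [x'|] // [<-].
move=> /prefix_ncons[er]; subst r'.
rewrite /= => /andP[/eqP-> /andP[/eqP-> h]].
have ex := atom_prefix ei ej h; subst x'.
by rewrite (acc_ratio _ (e_inj ei ej)).
Qed.

Variables (a : R) (y : nat -> bool).
Hypothesis optU : optimal U.
Hypothesis ya : binary_value R y = a.
Hypothesis rndy : random_seq U y.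
Hypothesis leN : forall s, (dyadic R (N s) s <= a)%R.
Hypothesis supN : forall r, (r < a)%R -> exists s, (r < dyadic R (N s) s)%R.

(** Blocking at [c = 2r] describes [2r + size tau] bits of [a] by
    [r + size tau + 3] bits, so it must stop occurring as [r] grows. *)
Lemma random_never_stuck : exists r0, forall r, r0 <= r ->
  forall s0, exists2 s, s0 <= s & fires N e r.*2 s.
Proof.
have [M pfM hM] := machine_of_enumeration eff_guess guess_prefix.
have [c hc] := optimal_random_bound optU rndy pfM.
exists c.+4 => r rc s0; apply: contrapT => nfires.
have stuck s : s0 <= s -> ~~ fires N e r.*2 s.
  by move=> s0s; apply/negP => f; case: nfires; exists s.
have [p ep ap] := stuck_bound N2 supN stuck.
set A := acc N e r.*2 s0 in ap; set m := r.*2 + size p.1 in ap.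
pose v := str_val (restr y m); pose k := A * 2 ^ m %/ 2 ^ s0.
have kA : k * 2 ^ s0 <= A * 2 ^ m by exact: leq_trunc_div.
have Ak : A * 2 ^ m < k.+1 * 2 ^ s0 by rewrite -ltn_divLR ?expn_gt0.
(* [a] lies in the interval of [restr y m] and within [2 ^- m] above [A / 2 ^ s0] *)
have h1 : k <= v.+1.
  have : (dyadic R k m <= dyadic R v.+1 m)%R.
    apply: (@le_trans _ _ (dyadic R A s0)); first by rewrite dyadic_le.
    apply: (@le_trans _ _ a); last by rewrite -ya binary_value_le.
    by apply: le_trans (leN s0); rewrite dyadic_le leq_mul2r acc_le ?orbT.
  by rewrite dyadic_le leq_pmul2r ?expn_gt0.
have h2 : v < k.+2.
  have : (dyadic R v m < dyadic R k.+2 m)%R.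
    apply: (@le_lt_trans _ _ a); first by rewrite -ya binary_value_ge.
    apply: (le_lt_trans ap); rewrite -[k.+2]addn1 dyadicD ltrD2r.
    by rewrite dyadic_lt.
  by rewrite dyadic_lt ltn_pmul2r ?expn_gt0.
(* the candidate [k + (b + b') - 1] must hit [v] *)
have [b [b' hb]] : exists b b' : nat, odd b + odd b' = v.+1 - k.
  have : v.+1 - k <= 2 by lia.
  by case: (v.+1 - k) => [|[|[|//]]] _; [exists 0, 0|exists 0, 1|exists 1, 1].
have hword : M (ncons r true (false :: odd b :: odd b' :: p.1)) = Some (restr y m).
  apply/(hM (_, _)); exists <| r, <| s0, <| b, b' |> |> |>.
  rewrite /guess; do ?[rewrite Cantor.cancel_of_to /=].
  rewrite ep -/m -/A -/k hb subnKC // succnK.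
  by rewrite -[bits m v]/(bits m (str_val (restr y m))) -{1}(size_restr y m) str_valK.
by have := hc _ _ hword; rewrite size_ncons /= /m -addnn; lia.
Qed.
End Compress.
End Reals.

(** * The optimal machine with the prescribed sum *)

Section Build.
Variables (U : seq bool -> option (seq bool)) (C : seq bool -> Prop).
Variables (N : nat -> nat) (e : nat -> option (seq bool * seq bool)) (c : nat).
Hypothesis optU : optimal U.
Hypotheses (eN : effective N) (ee : effective e).
Hypothesis N2 : forall s, (N s).*2 <= N s.+1.
Hypothesis eP : enumerates e (fun p => U p.1 = Some p.2 /\ C p.2).
Hypothesis C_zeros : forall n, C (zeros n).
Hypothesis unb : forall s0, exists2 s, s0 <= s & fires N e c s.

Let A s := acc N e c s.
Hypothesis A_bound : forall s, A s * 2 ^ c + 2 ^ s <= 2 ^ c * 2 ^ s.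

Definition atom (s : nat) : option (seq bool * seq bool) :=
  if fires N e c s then e (idx N e c s) else None.

Definition gap (s : nat) : nat := acc N e c s.+1 - (acc N e c s).*2.

Definition unit_wt (s : nat) (p : seq bool * seq bool) : nat :=
  2 ^ (s.+1 - (c + size p.1)).

Definition atom_wt (s : nat) (sg : seq bool) : nat :=
  if atom s is Some p then if p.2 == sg then unit_wt s p else 0 else 0.

(** The length of the first string of zeros that may receive a codeword at stage
    [s]: it exceeds the lengths of the outputs of all atoms listed up to then
    (by [size_le_str_code]), and it grows by at least [2 ^ (s + 1)] from stage [s] to
    the next, which is a bound on the number of codewords given at stage [s]. *)
Definition base (s : nat) : nat :=
  2 ^ s.+1 + bsum s.+1 (fun j => if e j is Some p then (enc p.2).+1 else 0).

Definition fresh (f : nat -> nat) (s : nat) (sg : seq bool) : bool :=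
  bex (f s) (fun k => zeros (base s + k) == sg).

(** [2 ^ s * 2 ^- k], where [k] is the length of the shortest description given
    to [sg] before stage [s], counting the copies of the programs of atoms that have
    been paid for, and the codewords.  The number [f j] of codewords given at stage
    [j] is a parameter, as it is defined in terms of the weights at stage [j]. *)
Definition wt (f : nat -> nat) (s : nat) (sg : seq bool) : nat :=
  iteri s (fun s u => maxn (maxn u.*2 (atom_wt s sg)) (fresh f s sg)) 0.

(** The truncated difference is what the maximum in [wt] adds to the doubled
    weight when the copy of the atom becomes available. *)
Definition increase (f : nat -> nat) (s : nat) (sg : seq bool) : nat :=
  atom_wt s sg - (wt f s sg).*2.

(** What the growth of the approximation exceeds the growth of the weights by,
    in units of [2 ^- (s + 1)]; one codeword of length [s + 1] makes up for a unit. *)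
Definition quota_of (f : nat -> nat) (s : nat) : nat :=
  gap s - (if atom s is Some p then increase f s p.2 else 0).

Definition lookup (h : seq nat) (s j : nat) : nat := nth 0 h (s.-1 - j).

Definition next_quota (h : seq nat) (s : nat) : nat := quota_of (lookup h s) s.

(** The quotas of the earlier stages, the latest first: each quota depends on the
    weights and thereby on all earlier quotas. *)
Definition hist (s : nat) : seq nat :=
  iteri s (fun s h => next_quota h s :: h) [::].

Definition quota (s : nat) : nat := next_quota (hist s) s.

Lemma eff_gap : effective gap.
Proof. by have h := eff_state eN ee; rewrite /gap /acc; eff_tac. Qed.

Lemma eff_atom : effective atom.
Proof.
have h := eff_state eN ee; have h' := eff_paid eN ee.
rewrite /atom /fires /idx; apply: eff_if; last by eff_tac.
  by apply: (eff_app3 h'); eff_tac.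
by eff_tac.
Qed.

Lemma eff_base : effective base.
Proof. by rewrite /base; eff_tac. Qed.

Lemma eff_quota : effective quota.
Proof.
have ea := eff_atom; have eb := eff_base; have eg := eff_gap.
have eaw : effective2 atom_wt by rewrite /effective2 /atom_wt /unit_wt; eff_tac.
have ec : effective2 next_quota.
  by rewrite /next_quota /quota_of /increase /wt /fresh /lookup /zeros /maxn; eff_tac.
by rewrite /quota /hist; eff_tac.
Qed.

Lemma lookup_hist s j : j < s -> lookup (hist s) s j = quota j.
Proof.
rewrite /lookup; elim: s j => [|s IHs] j //.
rewrite ltnS leq_eqVlt => /orP[/eqP->|js]; first by rewrite subnn.
rewrite -(IHs _ js) [hist _]/= -/(hist s) succnK.
have -> : s - j = (s.-1 - j).+1 by lia.
by [].
Qed.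

Lemma wt_ext f g s sg : (forall j, j < s -> f j = g j) -> wt f s sg = wt g s sg.
Proof.
rewrite /wt; elim: s => [|s IHs] //= fg.
by rewrite IHs /fresh ?fg // => j js; rewrite fg // ltnW.
Qed.

Lemma quotaE s : quota s = quota_of quota s.
Proof.
rewrite /quota /next_quota /quota_of; case: (atom s) => [p|] //; congr (_ - _).
rewrite /increase; congr (_ - _.*2); apply: wt_ext => j js.
by rewrite (lookup_hist js).
Qed.

Let W := wt quota.

Lemma wtS s sg : W s.+1 sg = maxn (maxn (W s sg).*2 (atom_wt s sg)) (fresh quota s sg).
Proof. by []. Qed.

Lemma atomP s p : atom s = Some p ->
  [/\ e (idx N e c s) = Some p, fires N e c s, c + size p.1 <= s.+1 &
      (A s).*2 + unit_wt s p <= A s.+1].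
Proof.
rewrite /atom; case: ifP => // fs ep; split=> //; move: (fs);
  rewrite {1}/fires /paid -/(idx N e c s) ep => /andP[h1 h2] //.
by rewrite /A accS fs.
Qed.

Lemma gapE s : (A s).*2 + gap s = A s.+1.
Proof. by rewrite /gap subnKC // acc_double. Qed.

Lemma quota_le_gap s : quota s <= gap s.
Proof. by rewrite quotaE leq_subr. Qed.

Lemma A_lt s : A s < 2 ^ s.
Proof.
rewrite -(ltn_pmul2l (m := 2 ^ c)) ?expn_gt0 // mulnC.
by apply: leq_trans (A_bound s); rewrite -addn1 leq_add2l expn_gt0.
Qed.

Lemma quota_le s : quota s <= 2 ^ s.+1.
Proof.
apply: leq_trans (quota_le_gap s) _; apply: leq_trans (ltnW (A_lt s.+1)).
by rewrite -gapE leq_addl.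
Qed.

Lemma base_mono s : base s + 2 ^ s.+1 <= base s.+1.
Proof. by rewrite /base /bsum [in X in _ <= X]big_ord_recr /= [2 ^ s.+2]expnS; lia. Qed.

Lemma size_le_str_code s : size s <= str_code s.
Proof. by elim: s => //= b s IHs; case: b; lia. Qed.

Lemma atom_size s p : atom s = Some p -> size p.2 < base s.
Proof.
move=> /atomP[ep _ _ _]; have i_lt : idx N e c s < s.+1 by rewrite ltnS idx_le.
rewrite /base /bsum (bigD1 (Ordinal i_lt)) //= ep.
by have := size_le_str_code p.2; rewrite /enc /=; have := expn_gt0 2 s.+1; lia.
Qed.

Lemma atom_wtP s sg : 0 < atom_wt s sg ->
  exists p, [/\ atom s = Some p, p.2 = sg & atom_wt s sg = unit_wt s p].
Proof.
rewrite /atom_wt; case ea: (atom s) => [p|] //; case: eqP => // ep _.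
by exists p.
Qed.

Lemma freshP f s sg : reflect (exists2 k, k < f s & sg = zeros (base s + k)) (fresh f s sg).
Proof.
by apply: (iffP (bexP _ _)) => -[k kf]; [move/eqP=> <-|move=> ->]; exists k.
Qed.

Lemma wt_cases s sg (Q : Prop) : 0 < W s.+1 sg ->
  (0 < W s sg -> Q) ->
  (forall p, atom s = Some p -> p.2 = sg -> Q) ->
  (forall k, k < quota s -> sg = zeros (base s + k) -> Q) -> Q.
Proof.
rewrite wtS => h h1 h2 h3.
case: (posnP (W s sg)) => [w0|/h1//].
case: (posnP (atom_wt s sg)) => [a0|/atom_wtP[p [? ? _]]]; last exact: (h2 p).
case: (boolP (fresh quota s sg)) => [/freshP[k]|f0]; first exact: h3.
by move: h; rewrite w0 a0 (negbTE f0).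
Qed.

Lemma wt_size s sg : 0 < W s sg -> size sg < base s.
Proof.
elim: s => [|s IHs] // /wt_cases; have hb := base_mono s.
apply=> [/IHs|p /atom_size + <-|k kn ->]; try by lia.
by rewrite size_zeros; have := quota_le s; lia.
Qed.

Lemma wt_in_C s sg : 0 < W s sg -> C sg.
Proof.
elim: s => [|s IHs] // /wt_cases; apply=> // [p /atomP[ep _ _ _] <-|k _ ->] //.
by have [] : U p.1 = Some p.2 /\ C p.2 by apply/eP; eexists; exact: ep.
Qed.

(** The strings that receive codewords are longer than all strings with positive
    weight, so that a new codeword raises the sum of the weights by exactly one
    unit. *)
Lemma fresh_new s sg : fresh quota s sg -> W s sg = 0 /\ atom_wt s sg = 0.
Proof.
move=> /freshP[k _ ->]; split; apply/eqP; rewrite -leqn0 leqNgt; apply/negP.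
  by move=> /wt_size; rewrite size_zeros; lia.
by move=> /atom_wtP[p [/atom_size h ep _]]; move: h; rewrite ep size_zeros; lia.
Qed.

Lemma wtSE s sg : W s.+1 sg = (W s sg).*2 + increase quota s sg + fresh quota s sg.
Proof.
rewrite wtS; case: (boolP (fresh _ _ _)) => [/fresh_new[w0 a0]|_].
  by rewrite w0 a0 /increase a0.
by rewrite maxn0 addn0 maxnE.
Qed.

Lemma sum_fresh s (D : seq (seq bool)) : uniq D ->
  (forall sg, fresh quota s sg -> sg \in D) ->
  \sum_(sg <- D) (fresh quota s sg : nat) = quota s.
Proof.
move=> uD hD.
have -> : \sum_(sg <- D) (fresh quota s sg : nat) = size [seq sg <- D | fresh quota s sg].
  by rewrite size_filter -sum1_count [RHS]big_mkcond /=; apply: eq_bigr => i _; case: ifP.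
rewrite (perm_size (s2 := [seq zeros (base s + k) | k <- iota 0 (quota s)])).
  by rewrite size_map size_iota.
apply: uniq_perm; first exact: filter_uniq.
  rewrite map_inj_uniq ?iota_uniq // => k k' /(congr1 size).
  by rewrite !size_zeros => /addnI.
move=> sg; rewrite mem_filter; apply/andP/mapP => [[/freshP[k kn ->] _]|[k]].
  by exists k; rewrite ?mem_iota.
rewrite mem_iota => /andP[_ kn] ->; have h : fresh quota s (zeros (base s + k)).
  by apply/freshP; exists k.
by rewrite h hD.
Qed.

Lemma increaseE s sg : increase quota s sg =
  if atom s is Some p then if p.2 == sg then increase quota s p.2 else 0 else 0.
Proof.
rewrite /increase {1}/atom_wt; case ea: (atom s) => [p|] //.
by case: eqP => [ep|] //; rewrite /atom_wt ea ep eqxx.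
Qed.

(** The invariant of the construction, for an arbitrary finite set that contains
    the support, so that the same set serves at stages [s] and [s + 1]. *)
Lemma sum_wt s (D : seq (seq bool)) : uniq D -> (forall sg, 0 < W s sg -> sg \in D) ->
  \sum_(sg <- D) W s sg = A s.
Proof.
move=> uD; elim: s => [|s IHs] hD; first by rewrite big1.
have hD1 sg : 0 < W s sg -> sg \in D.
  by move=> h; apply: hD; rewrite wtSE; lia.
have hD2 sg : fresh quota s sg -> sg \in D.
  by move=> h; apply: hD; rewrite wtSE h; lia.
under eq_bigr do rewrite wtSE.
rewrite !big_split /= sum_fresh // -gapE.
have -> : \sum_(sg <- D) (W s sg).*2 = (A s).*2.
  by rewrite -(IHs hD1) -mul2n big_distrr /=; apply: eq_bigr => sg _; rewrite mul2n.
rewrite -addnA; congr (_ + _); rewrite quotaE /quota_of.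
case ea: (atom s) => [p|]; last first.
  by rewrite subn0 big1 // => sg _; rewrite increaseE ea.
have pD : p.2 \in D.
  apply: hD; rewrite wtS /atom_wt ea eqxx /unit_wt.
  by have := expn_gt0 2 (s.+1 - (c + size p.1)); lia.
rewrite (bigD1_seq p.2) //= big1 ?addn0; last first.
  by move=> sg /negbTE ne; rewrite increaseE ea eq_sym ne.
rewrite subnKC // /increase /atom_wt ea eqxx.
by have [_ _ _] := atomP ea; rewrite -gapE; lia.
Qed.

Lemma wt_double s sg : (W s sg).*2 <= W s.+1 sg.
Proof. by rewrite wtSE; lia. Qed.

Lemma wt_mono s k sg : W s sg * 2 ^ k <= W (s + k) sg.
Proof.
elim: k => [|k IHk]; first by rewrite muln1 addn0.
by rewrite addnS expnS; apply: leq_trans (wt_double _ _); lia.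
Qed.

Variable g : nat -> option (seq bool * seq bool).
Hypotheses (eg : effective g) (gP : enumerates g (graph U)).

(** The codewords of stage [s] are the consecutive strings of length [s + 1] that
    start at the previous approximation; since their number is at most [gap s], they
    stay below the present one. *)
Definition codeword (s k : nat) : seq bool := bits s.+1 ((acc N e c s).*2 + k).

Definition vgraph (w : nat) : option (seq bool * seq bool) :=
  let t := Cantor.of_nat w in
  if t.1 == 0 then
    if g t.2 is Some p then Some (ncons c true p.1, p.2) else None
  else
    let q := Cantor.of_nat t.2 in
    if q.2 < quota q.1 then Some (codeword q.1 q.2, zeros (base q.1 + q.2)) else None.

Lemma eff_vgraph : effective vgraph.
Proof.
have h := eff_state eN ee; have eb := eff_base; have en := eff_quota.
by rewrite /vgraph /codeword /acc /zeros; eff_tac.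
Qed.

Lemma vgraphP t sg : (exists w, vgraph w = Some (t, sg)) <->
  (exists2 u, t = ncons c true u & U u = Some sg) \/
  (exists s k, [/\ k < quota s, t = codeword s k & sg = zeros (base s + k)]).
Proof.
split=> [[w]|[[u -> /(gP (_, _))[w ew]]|[s [k [kn -> ->]]]]].
- rewrite /vgraph; case: ifP => _.
    case ep: (g _) => [p|] // [<- <-]; left; exists p.1 => //.
    by apply/gP; eexists; exact: ep.
  case: ifP => // kn [<- <-]; right.
  by exists (Cantor.of_nat (Cantor.of_nat w).2).1, (Cantor.of_nat (Cantor.of_nat w).2).2.
- by exists <| 0, w |>; rewrite /vgraph Cantor.cancel_of_to /= ew.
- exists <| 1, <| s, k |> |>.
  by rewrite /vgraph Cantor.cancel_of_to /= Cantor.cancel_of_to /= kn.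
Qed.

Lemma codeword_val s k : k < quota s ->
  [/\ size (codeword s k) = s.+1, str_val (codeword s k) = (A s).*2 + k &
      (A s).*2 + k < A s.+1].
Proof.
move=> kn; have h : (A s).*2 + k < A s.+1.
  by rewrite -gapE ltn_add2l (leq_trans kn) // quota_le_gap.
by split; rewrite ?size_bits ?str_val_bits //; exact: ltn_trans h (A_lt _).
Qed.

Lemma str_val_ones u :
  (2 ^ c).-1 * 2 ^ size u <= str_val (ncons c true u) /\ size (ncons c true u) = c + size u.
Proof.
rewrite size_ncons -cat_nseq str_val_cat; split=> //.
suff -> : str_val (nseq c true) = (2 ^ c).-1 by exact: leq_addr.
elim: {1 2}c => // n IHn; rewrite [nseq _ _]/= str_val_cons IHn size_nseq expnS.
by have := expn_gt0 2 n; lia.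
Qed.

(** The upper end of the dyadic interval of a codeword is at most
    [1 - 2 ^- c]. *)
Lemma codeword_lt s k : k < quota s ->
  (str_val (codeword s k)).+1 * 2 ^ c <= (2 ^ c).-1 * 2 ^ s.+1.
Proof.
move=> /codeword_val[_ -> h]; have := A_bound s.+1; rewrite -subn1 mulnBl mul1n => h'.
by apply: (leq_trans (n := A s.+1 * 2 ^ c)); [rewrite leq_mul2r h orbT|lia].
Qed.

(** Comparable strings have nested dyadic intervals.  Those of the strings
    [1^c u] lie in the last interval of length [2 ^- c] and those of the codewords
    before it; the codewords of different stages lie between different
    approximations. *)
Lemma vgraph_prefix w w' p q : vgraph w = Some p -> vgraph w' = Some q ->
  prefix p.1 q.1 -> p = q.
Proof.
case: p q => [t sg] [t' sg'] h h' /= tt'.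
have /vgraphP[[u et Uu]|[s [k [kn et ->]]]] : exists w, vgraph w = Some (t, sg)
  by exists w.
- have /vgraphP[[u' et' Uu']|[s' [k' [kn' et' ->]]]] : exists w, vgraph w = Some (t', sg')
    by exists w'.
    move: tt'; rewrite et et' -!cat_nseq prefix_catr // eqxx => uu'.
    have e' : u = u' by apply: optU.1.2 uu'; rewrite /= ?Uu ?Uu'.
    by move: Uu'; rewrite -e' Uu => -[->].
  move: tt'; rewrite et et' => /prefix_str_val[hsz /andP[h1 _]]; exfalso.
  have [v1 sz] := str_val_ones u; have := codeword_lt kn'.
  have [sz' _ _] := codeword_val kn'; rewrite sz sz' in h1 hsz.
  have e' : 2 ^ s'.+1 = 2 ^ size u * 2 ^ (s'.+1 - (c + size u)) * 2 ^ c.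
    by rewrite -!expnD; congr (2 ^ _); lia.
  rewrite e' !mulnA leq_pmul2r ?expn_gt0 // => h3.
  have h4 := leq_mul v1 (leqnn (2 ^ (s'.+1 - (c + size u)))).
  by have := leq_trans h3 (leq_trans h4 h1); rewrite ltnn.
- have /vgraphP[[u' et' Uu']|[s' [k' [kn' et' ->]]]] : exists w, vgraph w = Some (t', sg')
    by exists w'.
    move: tt'; rewrite et et' => /prefix_str_val[hsz /andP[_ h1]]; exfalso.
    have [v1 sz] := str_val_ones u'; have h3 := codeword_lt kn.
    have [sz' _ _] := codeword_val kn; rewrite sz sz' in h1 hsz.
    have := leq_ltn_trans v1 h1; rewrite -(ltn_pmul2r (expn_gt0 2 c)) ltnNge => /negP; apply.
    rewrite mulnAC; apply: leq_trans (leq_mul h3 (leqnn _)) _.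
    by rewrite -!mulnA -!expnD; apply: eq_leq; congr (_ * 2 ^ _); lia.
  move: tt'; rewrite et et' => /prefix_str_val[hsz /andP[h1 h2]].
  have [sz v lt1] := codeword_val kn; have [sz' v' lt2] := codeword_val kn'.
  rewrite sz sz' v v' in hsz h1 h2.
  case: (ltngtP s s') => ss'; last 1 first.
  - by move: h1 h2; rewrite ss' subnn !muln1 => h1 h2; have -> : k = k' by lia.
  - exfalso; have := acc_mono e N2 c s.+1 (s' - s.+1); rewrite subnKC // -/(A _) -/(A _).
    move: h2; have -> : s'.+1 - s.+1 = (s' - s.+1).+1 by lia.
    rewrite expnS; move: (2 ^ _) => P h2 h3.
    have : ((A s).*2 + k).+1 * P <= A s.+1 * P by rewrite leq_mul2r lt1 orbT.
    by lia.
  - by exfalso; lia.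
Qed.

Variable V : seq bool -> option (seq bool).
Hypotheses (pfV : prefix_free_machine V) (hV : enumerates vgraph (graph V)).

Lemma V_spec t sg : V t = Some sg <->
  (exists2 u, t = ncons c true u & U u = Some sg) \/
  (exists s k, [/\ k < quota s, t = codeword s k & sg = zeros (base s + k)]).
Proof. by rewrite -vgraphP; exact: (hV (t, sg)). Qed.

Lemma V_copy u sg : U u = Some sg -> V (ncons c true u) = Some sg.
Proof. by move=> h; apply/V_spec; left; exists u. Qed.

Lemma V_codeword s k : k < quota s -> V (codeword s k) = Some (zeros (base s + k)).
Proof. by move=> h; apply/V_spec; right; exists s, k. Qed.

Lemma V_optimal : optimal V.
Proof.
split=> // M /optU.2[d hd]; exists (d + c) => sg; have := hd sg.
case: (K M sg) => [m|]; last by case: (K V sg).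
case eU: (K U sg) => [l|] //= lm.
have [u ul /V_copy/K_le[n -> /=]] := K_attained eU.
by rewrite size_ncons; lia.
Qed.

(** Each weight comes from an actual description. *)
Lemma wt_le_K s sg : 0 < W s sg ->
  exists2 n, K V sg = Some n & W s sg * 2 ^ n <= 2 ^ s.
Proof.
elim: s => [|s IHs] //.
have step m : m <= s.+1 -> (exists2 n, K V sg = Some n & n <= m) ->
    exists2 n, K V sg = Some n & 2 ^ (s.+1 - m) * 2 ^ n <= 2 ^ s.+1.
  move=> ms [n kn nm]; exists n => //.
  by rewrite -expnD leq_exp2l //; lia.
rewrite wtS; case: (posnP (fresh quota s sg)) => [->|].
  rewrite maxn0 /maxn; case: ifP => _.
    move=> /atom_wtP[p [ep ps ->]].
    have [ei fs ls _] := atomP ep.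
    have [Up _] : U p.1 = Some p.2 /\ C p.2 by apply/eP; exists (idx N e c s).
    have := V_copy Up => /K_le; rewrite ps size_ncons => h.
    exact: step ls h.
  rewrite double_gt0 => /IHs[n kn h]; exists n => //.
  by rewrite expnS -mul2n -mulnA leq_mul2l h orbT.
case: (boolP (fresh _ _ _)) => // f _ _; have [-> ->] := fresh_new f.
move/freshP: f => [k kn es].
have := V_codeword kn => /K_le; have [-> _ _] := codeword_val kn.
by rewrite -es => /(step _ (leqnn _)); rewrite subnn.
Qed.

(** Each description of a string of [C] is accounted for at some stage: for a
    codeword this is its own stage, for the copy of a program the stage at which the
    atom is paid for. *)
Lemma K_le_wt sg n : C sg -> K V sg = Some n ->
  exists s0, forall s, s0 <= s -> 2 ^ s <= W s sg * 2 ^ n.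
Proof.
move=> Csg /K_attained[t tn /V_spec tV].
suff [s0 h0] : exists s0, 2 ^ s0 <= W s0 sg * 2 ^ n.
  exists s0 => s ss; rewrite -(subnKC ss) expnD.
  apply: (@leq_trans (W s0 sg * 2 ^ n * 2 ^ (s - s0))).
    by rewrite leq_mul2r h0 orbT.
  by rewrite mulnAC leq_mul2r wt_mono orbT.
case: tV => [[u et Uu]|[s [k [kn et es]]]].
  have [i ei] := (eP (u, sg)).1 (conj Uu Csg).
  have [s es fs] := every_index_fires unb i.
  have ea : atom s = Some (u, sg) by rewrite /atom fs es ei.
  have [_ _ ls _] := atomP ea.
  have nE : n = c + size u by rewrite -tn et size_ncons.
  exists s.+1; apply: (@leq_trans (atom_wt s sg * 2 ^ n)); last first.
    by rewrite leq_mul2r wtS; lia.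
  by rewrite /atom_wt ea eqxx /unit_wt -nE -expnD subnK // nE.
exists s.+1; have [sz _ _] := codeword_val kn.
have -> : n = s.+1 by rewrite -tn et sz.
have h : fresh quota s sg by apply/freshP; exists k.
by rewrite leq_pmull // wtS h; lia.
Qed.

Lemma wt_support s : exists D : seq (seq bool),
  [/\ uniq D, forall sg, (0 < W s sg)%N -> sg \in D & forall sg, sg \in D -> C sg].
Proof.
suff [D hD] : exists D : seq (seq bool), forall sg, (0 < W s sg)%N -> sg \in D.
  exists (undup [seq sg <- D | (0 < W s sg)%N]); split; first exact: undup_uniq.
    by move=> sg h; rewrite mem_undup mem_filter h hD.
  by move=> sg; rewrite mem_undup mem_filter => /andP[/wt_in_C].
elim: s => [|s [D hD]]; first by exists [::].
exists ((if atom s is Some p then [:: p.2] else [::]) ++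
        [seq zeros (base s + k) | k <- iota 0 (quota s)] ++ D) => sg /wt_cases; apply.
- by move=> /hD h; rewrite !mem_cat h !orbT.
- by move=> p -> <-; rewrite mem_cat mem_head.
- move=> k kn ->; rewrite !mem_cat; apply/orP; right; apply/orP; left.
  by apply/mapP; exists k => //; rewrite mem_iota.
Qed.

Lemma sum_wt_le s (l : seq (seq bool)) : uniq l -> \sum_(sg <- l) W s sg <= A s.
Proof.
move=> ul; have [D [uD hD _]] := wt_support s.
rewrite -(sum_wt (undup_uniq (l ++ D))) => [|sg /hD]; last first.
  by rewrite mem_undup mem_cat => ->; rewrite orbT.
apply: uniq_sub_le_big => //; try exact: undup_uniq.
- by move=> m n; exact: leq_addr.
- by move=> sg h; rewrite mem_undup mem_cat h.
Qed.

Section Real.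
Local Open Scope classical_set_scope.
Local Open Scope ring_scope.
Variables (R : realType) (a : R).
Hypothesis leN : forall s, dyadic R (N s) s <= a.
Hypothesis supN : forall r, r < a -> exists s, r < dyadic R (N s) s.

Lemma pow2_neg_ge0 k : 0 <= pow2_neg R k.
Proof. by case: k => //= n; rewrite invr_ge0 exprn_ge0. Qed.

Lemma wt_le_pow2 s sg : dyadic R (W s sg) s <= pow2_neg R (K V sg).
Proof.
case: (posnP (W s sg)) => [->|/wt_le_K[n -> h]].
  by rewrite /dyadic mul0r pow2_neg_ge0.
by rewrite /= -[X in _ <= X]mul1r -/(dyadic R 1 n) dyadic_le mul1n.
Qed.

Lemma pow2_le_wt sg : C sg -> exists s0, forall s, (s0 <= s)%N ->
  pow2_neg R (K V sg) <= dyadic R (W s sg) s.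
Proof.
move=> Csg; case ek: (K V sg) => [n|]; last first.
  by exists 0%N => s _; rewrite /= /dyadic divr_ge0 // exprn_ge0.
have [s0 h0] := K_le_wt Csg ek; exists s0 => s /h0 h.
by rewrite /= -[X in X <= _]mul1r -/(dyadic R 1 n) dyadic_le mul1n.
Qed.

Lemma sum_dyadic_wt s (D : seq (seq bool)) : uniq D ->
  (forall sg, (0 < W s sg)%N -> sg \in D) ->
  \sum_(sg <- D) dyadic R (W s sg) s = dyadic R (A s) s.
Proof.
by move=> uD hD; rewrite /dyadic -mulr_suml -natr_sum (sum_wt uD hD).
Qed.

(** At a payment the accepted approximation catches up with the true one, and
    there are payments at arbitrarily late stages. *)
Lemma acc_sup r : r < a -> exists s, r < dyadic R (A s) s.
Proof.
move=> /supN[s0 h0]; have [s ss fs] := unb s0; exists s.+1.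
apply: (lt_le_trans h0); rewrite /A accS fs.
rewrite -(dyadicM R (N s0) s0 (s.+1 - s0)) subnKC ?(leqW ss) //.
rewrite dyadic_le leq_mul2r; apply/orP; right.
by have := N_mono N2 s0 (s.+1 - s0); rewrite subnKC ?(leqW ss).
Qed.

(** Finite partial sums are dominated by the weights at a late stage, hence by
    approximations to [a]; conversely the weights at each stage are dominated by a
    finite partial sum. *)
Lemma esum_K : (\esum_(sg in [set sg | C sg]) (pow2_neg R (K V sg))%:E = a%:E)%E.
Proof.
apply/eqP; rewrite eq_le; apply/andP; split.
  apply: ub_ereal_sup => _ [X [/finite_seqP[l ->] lC] <-].
  have -> : [set` l] = [set` undup l].
    by apply/seteqP; split=> z /=; rewrite mem_undup.
  rewrite -fsbig_seq ?undup_uniq // sumEFin lee_fin.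
  have [s hs] : exists s, forall sg, sg \in l ->
      pow2_neg R (K V sg) <= dyadic R (W s sg) s.
    have [s0 h0] : exists s0, forall s, (s0 <= s)%N -> forall sg, sg \in l ->
        pow2_neg R (K V sg) <= dyadic R (W s sg) s.
      elim: l lC => [|z l IHl] lC; first by exists 0%N.
      have [|s1 h1] := IHl; first by move=> y yl; apply: lC; rewrite /= inE yl orbT.
      have [|s2 h2] := @pow2_le_wt z; first by apply: lC; rewrite /= mem_head.
      exists (maxn s1 s2) => s; rewrite geq_max => /andP[ss1 ss2] y.
      by rewrite inE => /predU1P[->|]; [exact: h2|exact: h1].
    by exists s0; exact: h0.
  apply: (le_trans _ (leN s)).
  apply: (@le_trans _ _ (\sum_(sg <- undup l) dyadic R (W s sg) s)).
    by rewrite big_seq [leRHS]big_seq; apply: ler_sum => sg; rewrite mem_undup => /hs.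
  rewrite /dyadic -mulr_suml -natr_sum ler_pM2r ?invr_gt0 ?exprn_gt0 // ler_nat.
  exact: leq_trans (sum_wt_le _ (undup_uniq _)) (acc_le _ N2 _ _).
apply/lee_addgt0Pr => eps eps0.
have [|s hs] := @acc_sup (a - eps); first by rewrite ltrBlDr ltrDl.
have [D [uD hD DC]] := wt_support s.
apply: (@le_trans _ _ ((dyadic R (A s) s)%:E + eps%:E)%E).
  by rewrite -EFinD lee_fin -lerBlDr ltW.
rewrite leeD2r //; apply: esum_ge; exists [set` D].
  by split; [exact: finite_seq|move=> sg /DC].
rewrite -fsbig_seq // sumEFin lee_fin -(sum_dyadic_wt uD hD).
by apply: ler_sum => sg _; exact: wt_le_pow2.
Qed.
End Real.
End Build.

(** * The theorem *)

Local Open Scope ring_scope.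

(** The room that the prefix [1^c] needs, expressed in integers. *)
Lemma acc_bound (R : realType) N e c s (a : R) :
  (forall s, ((N s).*2 <= N s.+1)%N) -> dyadic R (N s) s <= a ->
  a + dyadic R 1 c <= 1 -> (acc N e c s * 2 ^ c + 2 ^ s <= 2 ^ c * 2 ^ s)%N.
Proof.
move=> N2 leN ac.
have : dyadic R (acc N e c s * 2 ^ c + 2 ^ s) (s + c) <= dyadic R 1 0.
  rewrite dyadicD dyadicM [(s + c)%N]addnC -[(2 ^ s)%N]mul1n dyadicM.
  apply: le_trans (_ : a + dyadic R 1 c <= _); last by rewrite {2}/dyadic expr0 divr1.
  by rewrite lerD2r (le_trans _ leN) // dyadic_le leq_mul2r acc_le ?orbT.
by rewrite dyadic_le expn0 muln1 mul1n expnD [(2 ^ s * _)%N]mulnC.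
Qed.

Theorem theorem6p7 (R : realType) (U : seq bool -> option (seq bool))
    (hU : optimal U) (x : nat -> bool) (a : R)
    (hx : left_ce (binary_value R x))
    (ha01 : 0 <= a <= 1) (ha : left_ce a) (har : random_real U a) :
  exists V : seq bool -> option (seq bool), optimal V /\ f_ R V x = (a%:E)%E.
Proof.
case: har => y ya rndy; have /andP[a0 _] := ha01.
have [N [eN N2 leN supN]] := left_ce_approx a0 ha.
have [gC egC gCP] := cut_enumerable hx.
have [e [ee eP e_inj]] := atoms_enumerable hU.1.1 egC gCP.
have [g eg gP] := graph_enumerable hU.1.1.
have [r0 hr0] := random_never_stuck (C := fun s => le_L s x)
  hU.1 eN ee N2 eP e_inj hU ya rndy leN supN.
have a1 : 0 < 1 - a by rewrite subr_gt0 -ya (binary_value_lt1 R hU rndy).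
have [n0 hn0] := small_pow2 a1.
pose c := (maxn r0 n0).*2.
have unb := hr0 (maxn r0 n0) (leq_maxl _ _).
have A_bound s : (acc N e c s * 2 ^ c + 2 ^ s <= 2 ^ c * 2 ^ s)%N.
  apply: (acc_bound e N2 (leN s)); rewrite addrC -lerBrDr; apply: hn0.
  by rewrite /c -addnn; apply: leq_trans (leq_maxr r0 n0) (leq_addr _ _).
have [V pfV hV] := machine_of_enumeration (eff_vgraph c eN ee eg)
  (vgraph_prefix hU N2 A_bound gP).
exists V; split; first exact: (V_optimal hU gP pfV hV).
exact: (esum_K (C := fun s => le_L s x) N2 eP (le_L_zeros x) unb A_bound gP hV leN supN).
Qed.
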